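(* Let $\lambda,\mu$ be partitions with at most $n$ parts and $\mu\subseteq\lambda$, and let $\mathbf r=(r_1,\dots,r_n),\mathbf s=(s_1,\dots,s_n)$ be sequences of positive integers such that $r_i\le r_{i+1}$ and $s_i\le s_{i+1}$ whenever $\mu_i<\lambda_{i+1}$ ($1\le i\le n-1$). Then \[ G^{\mathrm{row}(\mathbf r,\mathbf s)}_{\lambda/\mu}(\mathbf x;\boldsymbol\alpha,\boldsymbol\beta)=C\det\Big(h_{\lambda_i-\mu_j-i+j}\big[X_{[r_j,s_i]}\ominus(A_{\lambda_i}-A_{\mu_j}-B_{i-1}+B_j)\big]\Big)_{i,j=1}^n, \qquad C=\prod_{i=1}^n\prod_{l=r_i}^{s_i}(1-\beta_ix_l). \]
   Context: Parameters $\boldsymbol\alpha,\boldsymbol\beta$; $A_k=\alpha_1+\dots+\alpha_k$, $B_k=\beta_1+\dots+\beta_k$ for $k\ge1$, $A_k=B_k=0$ for $k\le0$; $X_{[r,s]}=x_r+\dots+x_s$ ($=0$ if $r>s$). For a formal $\mathbb Z$-linear combination $Z=\sum_uc_uu$ of variables/parameters, $\sum_{m\ge0}h_m[Z]t^m=\prod_u(1-ut)^{-c_u}$, $h_m[Z]=0$ for $m<0$; for two such combinations and any integer $m$, $h_m[Y\ominus W]=\sum_{a,b\ge0,\,a-b=m}h_a[Y]h_b[W]$. A marked multiset-valued tableau of shape $\lambda/\mu$ is a filling $T$ of each cell $(i,j)$ with a nonempty multiset $\{a_1\le\dots\le a_k\}$ of positive integers, in which each $a_t$ with $t\ge2$ and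 $a_{t-1}<a_t$ may be marked, such that $\max T(i,j)\le\min T(i,j+1)$ and $\max T(i,j)<\min T(i+1,j)$ whenever the cells lie in the shape. Weight: $\mathrm{wt}(T)=\prod_{(i,j)}\mathbf x^{T(i,j)}\alpha_j^{u(T(i,j))-1}(-\beta_i)^{m(T(i,j))}$, where $\mathbf x^{T(i,j)}$ is the product of $x_k$ over all elements $k$ (marked or not) of $T(i,j)$ with multiplicity, and $u$, $m$ count unmarked and marked elements. $G^{\mathrm{row}(\mathbf r,\mathbf s)}_{\lambda/\mu}(\mathbf x;\boldsymbol\alpha,\boldsymbol\beta)$ is the sum of $\mathrm{wt}(T)$ over such tableaux with $r_i\le\min T(i,j)$ and $\max T(i,j)\le s_i$ for all cells $(i,j)$. *)

(* Defs.v *)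
From HB Require Import structures.
From mathcomp Require Import all_boot all_order all_algebra finmap.
From mathcomp Require Import boolp classical_sets functions cardinality fsbigop.
From mathcomp Require Import monalg.

Set Implicit Arguments.
Unset Strict Implicit.
Unset Printing Implicit Defensive.

Import Order.TTheory GRing.Theory Num.Theory.

Local Open Scope classical_set_scope.
Local Open Scope ring_scope.

HB.mixin Record ConomialDef_isLocFinite M of ConomialDef M := {
  finite_factors : forall m : M, finite_set [set p : M * M | mmul p.1 p.2 = m]
}.

#[short(type="lfMonomType")]
HB.structure Definition LocFinMonom :=
  { M of ConomialDef M & ConomialDef_isLocFinite M }.

Record fps (M : Type) (R : Type) := FPS { fcoef : M -> R }.

Lemma fpsP (M R : Type) (f g : fps M R) : fcoef f =1 fcoef g -> f = g.
Proof. by case: f g => [f] [g] /= /funext ->. Qed.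

HB.instance Definition _ (M R : Type) := gen_eqMixin (fps M R).
HB.instance Definition _ (M R : Type) := gen_choiceMixin (fps M R).

(* The sum of a family of series, taken coefficient by coefficient. As always
   with [\sum_(i \in A)], a coefficient to which infinitely many members of the
   family contribute gets the junk value 0; in the families summed below every
   monomial occurs in finitely many members only. *)
Definition fps_sum (M : Type) (R : nmodType) (I : choiceType) (A : set I)
    (F : I -> fps M R) : fps M R :=
  FPS (fun m => \sum_(i \in A) fcoef (F i) m).

Section FpsZmod.
Context {M : Type} {R : zmodType}.
Implicit Types f g : fps M R.

Definition fps0 : fps M R := FPS (fun=> 0).
Definition fps_opp f : fps M R := FPS (fun m => - fcoef f m).
Definition fps_add f g : fps M R := FPS (fun m => fcoef f m + fcoef g m).

Fact fps_addA : associative fps_add.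
Proof. by move=> f g h; apply: fpsP => m /=; rewrite addrA. Qed.
Fact fps_addC : commutative fps_add.
Proof. by move=> f g; apply: fpsP => m /=; rewrite addrC. Qed.
Fact fps_add0 : left_id fps0 fps_add.
Proof. by move=> f; apply: fpsP => m /=; rewrite add0r. Qed.
Fact fps_addN : left_inverse fps0 fps_opp fps_add.
Proof. by move=> f; apply: fpsP => m /=; rewrite addNr. Qed.

HB.instance Definition _ := GRing.isZmodule.Build (fps M R)
  fps_addA fps_addC fps_add0 fps_addN.

Lemma fcoef0 m : fcoef (0 : fps M R) m = 0. Proof. by []. Qed.
Lemma fcoefN f m : fcoef (- f) m = - fcoef f m. Proof. by []. Qed.
Lemma fcoefD f g m : fcoef (f + g) m = fcoef f m + fcoef g m. Proof. by []. Qed.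
Lemma fcoefB f g m : fcoef (f - g) m = fcoef f m - fcoef g m. Proof. by []. Qed.
End FpsZmod.

Section FpsRing.
Context {M : lfMonomType} {R : comNzRingType}.
Implicit Types (f g h : fps M R) (m k : M).

Definition fps_mono m (c : R) : fps M R := FPS (fun k => c *+ (k == m)).

Definition fps_mul f g : fps M R :=
  FPS (fun m => \sum_(p \in [set p : M * M | mmul p.1 p.2 = m])
                  fcoef f p.1 * fcoef g p.2).

Definition factors_in m (L : seq M) :=
  uniq L /\ forall a b, mmul a b = m -> (a \in L) && (b \in L).

Lemma factors_ex m : exists L, factors_in m L.
Proof.
pose S : seq (M * M) := fset_set [set p : M * M | mmul p.1 p.2 = m].
exists (undup (map fst S ++ map snd S)); split; first exact: undup_uniq.
move=> a b abm.
have abS : (a, b) \in S.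
  by rewrite /S in_fset_set; [exact: mem_set | exact: finite_factors].
by rewrite !mem_undup !mem_cat (map_f fst abS) (map_f snd abS) orbT.
Qed.

Lemma factors_in_sub m k k' L : factors_in m L -> mmul k k' = m ->
  factors_in k L.
Proof.
move=> [uL Lm] kk'; split=> // a b abk.
have /andP[-> _] : (a \in L) && (mmul b k' \in L).
  by apply: Lm; rewrite mulmA abk.
have /andP[-> _] // : (b \in L) && (mmul a k' \in L).
by apply: Lm; rewrite mulmA (mulmC b) abk.
Qed.

Lemma fps_mulE f g m L : factors_in m L ->
  fcoef (fps_mul f g) m =
  \sum_(a <- L) \sum_(b <- L) (fcoef f a * fcoef g b) *+ (mmul a b == m).
Proof.
move=> [uL Lm] /=.
pose L2 := [seq p <- [seq (a, b) | a <- L, b <- L] | mmul p.1 p.2 == m].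
have -> : [set p : M * M | mmul p.1 p.2 = m] = [set` L2].
  apply/seteqP; split => -[a b] /=; rewrite mem_filter.
    by move=> abm; rewrite abm eqxx; have /andP[aL bL] := Lm _ _ abm;
       apply/allpairsP; exists (a, b).
  by move=> /andP[/eqP].
rewrite -fsbig_seq; last first.
  by rewrite filter_uniq // allpairs_uniq // => -[? ?] [? ?] _ _ [-> ->].
rewrite big_filter big_mkcond big_allpairs /=; apply: eq_bigr => a _.
by apply: eq_bigr => b _; case: eqP.
Qed.

Fact fps_mulC : commutative fps_mul.
Proof.
move=> f g; apply: fpsP => m; have [L Lm] := factors_ex m.
rewrite !(fps_mulE _ _ Lm) exchange_big /=.
by do 2!apply: eq_bigr => ? _; rewrite mulrC mulmC.
Qed.

Fact fps_mulDl : left_distributive fps_mul +%R.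
Proof.
move=> f g h; apply: fpsP => m; have [L Lm] := factors_ex m.
rewrite fcoefD !(fps_mulE _ _ Lm) -big_split; apply: eq_bigr => a _.
by rewrite -big_split; apply: eq_bigr => b _; rewrite fcoefD mulrDl mulrnDl.
Qed.

Fact fps_mono_mulE m c f k k' : mmul m k = k' ->
  (forall j, mmul m j = k' -> j = k) ->
  fcoef (fps_mul (fps_mono m c) f) k' = c * fcoef f k.
Proof.
move=> mk km; have [L Lk'] := factors_ex k'.
have [uL /(_ _ _ mk)/andP[mL kL]] := Lk'.
rewrite (fps_mulE _ _ Lk') (bigD1_seq m) //= (bigD1_seq k) //= mk !eqxx !mulr1n.
rewrite [X in _ + X + _]big1 => [|j /eqP jk].
  rewrite [X in _ + X]big1 ?addr0 // => j jm.
  by rewrite big1 // => i _; rewrite (negPf jm) mulr0n mul0r mul0rn.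
by case: eqP => // /km.
Qed.

Fact fps_mul1 : left_id (fps_mono mone 1) fps_mul.
Proof.
move=> f; apply: fpsP => m.
by rewrite (@fps_mono_mulE _ _ _ m) ?mul1m ?mul1r // => j; rewrite mul1m.
Qed.

Lemma fps_mul3E f g h m L : factors_in m L ->
  fcoef (fps_mul (fps_mul f g) h) m =
  \sum_(a <- L) \sum_(b <- L) \sum_(c <- L)
    (fcoef f a * fcoef g b * fcoef h c) *+ (mmul (mmul a b) c == m).
Proof.
move=> Lm; have [uL inL] := Lm; rewrite (fps_mulE _ _ Lm).
transitivity (\sum_(k <- L) \sum_(c <- L) \sum_(a <- L) \sum_(b <- L)
   (fcoef f a * fcoef g b * fcoef h c) *+
     ((mmul a b == k) && (mmul k c == m))).
  apply: eq_bigr => k _; apply: eq_bigr => c _.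
  have [kcm|_] := eqVneq (mmul k c) m; last first.
    rewrite mulr0n big1 // => a _; rewrite big1 // => b _.
    by rewrite andbF.
  rewrite (fps_mulE _ _ (factors_in_sub Lm kcm)) mulr1n mulr_suml.
  apply: eq_bigr => a _; rewrite mulr_suml; apply: eq_bigr => b _.
  by rewrite andbT mulrnAl.
rewrite (eq_bigr _ (fun k _ => exchange_big _ _ _ _ _ _)) exchange_big /=.
apply: eq_bigr => a _.
under eq_bigr do rewrite exchange_big /=.
rewrite exchange_big /=; apply: eq_bigr => b _.
rewrite exchange_big /=; apply: eq_bigr => c _.
have [abcm|abcm] := eqVneq (mmul (mmul a b) c) m.
  have /andP[abL _] := inL _ _ abcm.
  rewrite (bigD1_seq (mmul a b)) //= eqxx abcm eqxx big1 ?addr0 // => k kab.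
  by rewrite eq_sym (negPf kab).
rewrite big1 // => k _; case: eqP => //= <-.
by rewrite (negPf abcm).
Qed.

Fact fps_mulA : associative fps_mul.
Proof.
move=> f g h; apply: fpsP => m; have [L Lm] := factors_ex m.
rewrite fps_mulC !(fps_mul3E _ _ _ Lm) [RHS]exchange_big /=.
rewrite [RHS](eq_bigr _ (fun _ _ => exchange_big _ _ _ _ _ _)) /=.
apply: eq_bigr => b _; apply: eq_bigr => c _; apply: eq_bigr => a _.
by rewrite mulrC mulrA mulmC mulmA.
Qed.

Fact fps1_neq0 : fps_mono mone 1 != 0.
Proof.
apply/eqP => /(congr1 (fun f => fcoef f mone))/eqP.
by rewrite /= eqxx mulr1n oner_eq0.
Qed.

HB.instance Definition _ := GRing.Zmodule_isComNzRing.Build (fps M R)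
  fps_mulA fps_mulC fps_mul1 fps_mulDl fps1_neq0.

Lemma fcoef1 m : fcoef (1 : fps M R) m = (m == mone)%:R. Proof. by []. Qed.

Lemma fcoefM f g m : fcoef (f * g) m =
  \sum_(p \in [set p : M * M | mmul p.1 p.2 = m]) fcoef f p.1 * fcoef g p.2.
Proof. by []. Qed.

Definition fps_unit : pred (fps M R) := fun f => `[< exists g, g * f = 1 >].
Definition fps_inv f : fps M R :=
  if pselect (exists g, g * f = 1) is left ex then projT1 (cid ex) else f.

Fact fps_mulV : {in fps_unit, left_inverse 1 fps_inv *%R}.
Proof.
by move=> f /asboolP ex; rewrite /fps_inv; case: pselect => // e; case: cid.
Qed.
Fact fps_unitP f g : g * f = 1 -> fps_unit f.
Proof. by move=> gf; apply/asboolP; exists g. Qed.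
Fact fps_inv_out : {in [predC fps_unit], fps_inv =1 id}.
Proof.
move=> f /negP nf; rewrite /fps_inv; case: pselect => // ex.
by case: nf; apply/asboolP.
Qed.

HB.instance Definition _ := GRing.ComNzRing_hasMulInverse.Build (fps M R)
  fps_mulV fps_unitP fps_inv_out.
End FpsRing.

(* In [fps nat S] the monomial [t ^ m] is [m : nat]. *)

Fact addn_unit (m n : nat) : addn m n = 0%N -> m = 0%N /\ n = 0%N.
Proof. by case: m n => [] []. Qed.

HB.instance Definition _ :=
  Choice_isMonomialDef.Build nat addnA add0n addn0 addn_unit.
HB.instance Definition _ := MonomialDef_isConomialDef.Build nat addnC.

Fact nat_finite_factors (m : nat) :
  finite_set [set p : nat * nat | mmul p.1 p.2 = m].
Proof.
apply: (@sub_finite_set _ _ (`I_m.+1 `*` `I_m.+1)).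
  by move=> [a b] /= <-; rewrite /mmul /= !ltnS leq_addr leq_addl.
by apply: finite_setX; exact: finite_II.
Qed.

HB.instance Definition _ := ConomialDef_isLocFinite.Build nat nat_finite_factors.

(* 1 - u t is invertible, with inverse the geometric series *)
Lemma fps_geomP (S : comNzRingType) (u : S) :
  FPS (fun k : nat => u ^+ k) * (1 - fps_mono 1%N u) = 1.
Proof.
rewrite mulrC mulrBl mul1r; apply: fpsP => -[|k]; rewrite fcoefB fcoef1 /=.
  rewrite fsbig1 ?subr0 // => -[[|a] b] /= ab; rewrite /mmul /= in ab => //.
  by rewrite mulr0n mul0r.
have /= -> := @fps_mono_mulE nat S 1%N u (FPS (fun k : nat => u ^+ k)) k k.+1.
- by rewrite -exprS subrr.
- by [].
- by move=> j; exact: succn_inj.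
Qed.

Lemma unit_1subt (S : comNzRingType) (u : S) :
  (1 - fps_mono 1%N u : fps nat S) \is a GRing.unit.
Proof. exact: fps_unitP (fps_geomP u). Qed.

Fact cmonom_finite_factors (I : choiceType) (m : {cmonom I}) :
  finite_set [set p : {cmonom I} * {cmonom I} | mmul p.1 p.2 = m].
Proof.
pose D := finsupp (cmonom_val m).
pose N := (\max_(i <- D) m i)%N.
pose mk (f : {ffun D -> 'I_N.+1}) : {cmonom I} :=
  mkcmonom [fsfun i : D => f i : nat].
pose G (q : {ffun D -> 'I_N.+1} * {ffun D -> 'I_N.+1}) := (mk q.1, mk q.2).
apply: (@sub_finite_set _ _ (G @` [set: _])); last first.
  by apply: finite_image; exact: finite_finset.
have bnd (a b : {cmonom I}) : mmul a b = m -> exists f, mk f = a.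
  move=> abm.
  have am i : (a i <= m i)%N.
    by rewrite -abm; have -> := mulcmE a b i; exact: leq_addr.
  exists [ffun i : D => inord (a (val i))].
  apply/eqP/cmP => i; rewrite /mk cmE fsfun_ffun.
  case: insubP => [j jD ji|iD] /=.
    rewrite ffunE ji inordK // ltnS (leq_trans (am i)) // /N.
    exact: (leq_bigmax_seq i).
  have : m i = 0%N by apply: fsfun_dflt.
  by move: (am i) => /[swap] ->; rewrite leqn0 => /eqP ->.
move=> [a b] /= abm.
have [f fa] := bnd a b abm.
have [g gb] : exists g, mk g = b by apply: (bnd b a); rewrite mulmC.
by exists (f, g) => //; rewrite /G /= fa gb.
Qed.

HB.instance Definition _ (I : choiceType) :=
  ConomialDef_isLocFinite.Build {cmonom I} (@cmonom_finite_factors I).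

(* [Xl k], [Al k], [Be k] stand for x_k, alpha_k, beta_k with k >= 1; the
   index 0 is not used. *)
Inductive letter := Xl of nat | Al of nat | Be of nat.

Definition letter_code (u : letter) : nat + (nat + nat) :=
  match u with Xl k => inl k | Al k => inr (inl k) | Be k => inr (inr k) end.
Definition letter_decode (c : nat + (nat + nat)) : letter :=
  match c with inl k => Xl k | inr (inl k) => Al k | inr (inr k) => Be k end.
Fact letter_codeK : cancel letter_code letter_decode. Proof. by case. Qed.

HB.instance Definition _ := Countable.copy letter (can_type letter_codeK).

Notation pseries := (fps {cmonom letter} int).

Definition var (u : letter) : pseries := fps_mono (ucm u) 1.

Notation lincomb := {malg int[letter]}.

Definition alphas (k : nat) : lincomb := \sum_(1 <= l < k.+1) << Al l >>.
Definition betas (k : nat) : lincomb := \sum_(1 <= l < k.+1) << Be l >>.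
Definition xs (r s : nat) : lincomb := \sum_(r <= k < s.+1) << Xl k >>.

Definition hgen (Z : lincomb) : fps nat pseries :=
  \prod_(u <- msupp Z) (1 - fps_mono 1%N (var u)) ^ (- Z@_u).

Definition hcompl (m : nat) (Z : lincomb) : pseries := fcoef (hgen Z) m.

(* Coefficientwise finite: [hcompl a Y * hcompl b W] is homogeneous of degree
   a + b, where the letters all have degree 1. *)
Definition h_ominus (m : int) (Y W : lincomb) : pseries :=
  fps_sum [set p : nat * nat | p.1%:Z - p.2%:Z = m]
          (fun p => hcompl p.1 Y * hcompl p.2 W).

(* A multiset {a_1 <= ... <= a_k} is the sequence of the pairs (a_t, whether
   a_t is marked). *)
Notation mmset := (seq (nat * bool)).

Definition entries (S : mmset) : seq nat := [seq p.1 | p <- S].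
Definition mmin (S : mmset) : nat := head 0%N (entries S).
Definition mmax (S : mmset) : nat := last 0%N (entries S).
Definition unmarked (S : mmset) : nat := count (fun p => ~~ p.2) S.
Definition marked (S : mmset) : nat := count (fun p => p.2) S.

Definition mmset_step (p q : nat * bool) : bool :=
  (p.1 <= q.1)%N && (q.2 ==> (p.1 < q.1)%N).

Definition is_mmset (S : mmset) : bool :=
  [&& S != [::], all (fun a => 0 < a)%N (entries S),
      ~~ (head (0%N, false) S).2 & sorted mmset_step S].

(* The i-th row is indexed by [i - 1 : 'I_n]; columns are numbered from 1. *)
Definition is_partition (n : nat) (lam : 'I_n -> nat) : Prop :=
  forall i j : 'I_n, (i <= j)%N -> (lam j <= lam i)%N.

Definition in_skew (n : nat) (lam mu : 'I_n -> nat) (i : 'I_n) (j : nat) : bool :=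
  (mu i < j <= lam i)%N.

(* Fillings are total functions, constantly empty outside the shape, so that
   distinct functions are distinct fillings. *)
Record is_mmsvt (n : nat) (lam mu : 'I_n -> nat)
    (T : 'I_n -> nat -> mmset) : Prop := IsMmsvt {
  mmsvt_out : forall i j, ~~ in_skew lam mu i j -> T i j = [::];
  mmsvt_in : forall i j, in_skew lam mu i j -> is_mmset (T i j);
  mmsvt_row : forall i j, in_skew lam mu i j -> in_skew lam mu i j.+1 ->
    (mmax (T i j) <= mmin (T i j.+1))%N;
  mmsvt_col : forall (i i' : 'I_n) j, i' = i.+1 :> nat ->
    in_skew lam mu i j -> in_skew lam mu i' j ->
    (mmax (T i j) < mmin (T i' j))%N
}.

Definition row_flagged (n : nat) (lam mu r s : 'I_n -> nat)
    (T : 'I_n -> nat -> mmset) : Prop :=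
  forall i j, in_skew lam mu i j ->
    (r i <= mmin (T i j))%N /\ (mmax (T i j) <= s i)%N.

Definition mmset_wt (i j : nat) (S : mmset) : pseries :=
  (\prod_(a <- entries S) var (Xl a)) * var (Al j) ^+ (unmarked S).-1
  * (- var (Be i)) ^+ marked S.

Definition mmsvt_wt (n : nat) (lam mu : 'I_n -> nat)
    (T : 'I_n -> nat -> mmset) : pseries :=
  \prod_(i < n) \prod_((mu i).+1 <= j < (lam i).+1) mmset_wt i.+1 j (T i j).

(* Coefficientwise finite: the x-part of the weight determines the multiset of
   all the entries of T. *)
Definition G_row (n : nat) (lam mu r s : 'I_n -> nat) : pseries :=
  fps_sum [set T | is_mmsvt lam mu T /\ row_flagged lam mu r s T]
          (mmsvt_wt lam mu).

(* Main.v *)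
(* Both sides satisfy the same recursion in [lam] and the upper flag [s]. Take the
   last nonempty row [i] such that [s i] exceeds the flag of an overlapping row
   above, and let x be x_{s_i}. If its last cell is a corner, reading off the last
   element of that cell gives, with alpha = alpha_{lam_i} and beta = beta_i,
     (1 - alpha x) G(lam, s) = (1 - beta x) G(lam, s - e_i) + x G(lam - e_i, s);
   otherwise the row below has the same length and the same flag, and column
   strictness gives G(lam, s) = G(lam, s - e_i). In the determinant only row i
   changes, and
     h_m[Y + x - W] = h_m[Y - W] + x h_{m-1}[Y + x - W],
     h_m[Y - (W + u)] = h_m[Y - W] + u h_{m+1}[Y - (W + u)]
   (with - standing for the circled minus) yield the same two relations by
   multilinearity, the second one because two equal rows cancel. Entries with
   r_j > s_i need care: there X_{[r_j,s_i]} is 0 and does not lose x when s_i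
   decreases ([h_ominus_pred_vanish]). The recursion ends at
   lam = mu, where both sides are 1, or at a nonempty row with r_i > s_i, where
   both are 0. *)
Require Import Defs.
From HB Require Import structures.
From mathcomp Require Import all_boot all_order all_algebra finmap.
From mathcomp Require Import boolp classical_sets functions cardinality fsbigop.
From mathcomp Require Import monalg.
From mathcomp Require Import perm zify ring.

Import Order.TTheory GRing.Theory Num.Theory.
Local Open Scope ring_scope.
Local Open Scope classical_set_scope.

Set Implicit Arguments.
Unset Strict Implicit.
Unset Printing Implicit Defensive.

(** * Order of a series, and summable families *)

Definition order_ge (N : nat) (f : pseries) : Prop :=
  forall m : {cmonom letter}, (mdeg m < N)%N -> fcoef f m = 0.

Lemma order_ge0 (f : pseries) : order_ge 0 f.
Proof. by []. Qed.

Lemma order_ge_0 (N : nat) : order_ge N 0.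
Proof. by []. Qed.

Lemma order_geN (N : nat) (f : pseries) : order_ge N f -> order_ge N (- f).
Proof. by move=> of_ m mN; rewrite fcoefN of_ ?oppr0. Qed.

Lemma order_geD (N : nat) (f g : pseries) :
  order_ge N f -> order_ge N g -> order_ge N (f + g).
Proof. by move=> of_ og m mN; rewrite fcoefD of_ ?og ?addr0. Qed.

Lemma order_geB (N : nat) (f g : pseries) :
  order_ge N f -> order_ge N g -> order_ge N (f - g).
Proof. by move=> of_ og; apply: order_geD => //; exact: order_geN. Qed.

Lemma order_ge_sum (N : nat) (I : Type) (L : seq I) (P : pred I)
    (F : I -> pseries) :
  (forall i, P i -> order_ge N (F i)) -> order_ge N (\sum_(i <- L | P i) F i).
Proof.
by move=> oF; elim/big_ind: _ => // f g; exact: order_geD.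
Qed.

Lemma order_geW (M N : nat) (f : pseries) :
  (M <= N)%N -> order_ge N f -> order_ge M f.
Proof. by move=> MN of_ m mM; apply: of_; exact: leq_trans MN. Qed.

Lemma order_geM (a b : nat) (f g : pseries) :
  order_ge a f -> order_ge b g -> order_ge (a + b) (f * g).
Proof.
move=> of_ og m mab; rewrite fcoefM fsbig1 // => -[p q] /= pqm.
have := mdegM p q; rewrite pqm => md.
have [pa|ap] := ltnP (mdeg p) a; first by rewrite of_ ?mul0r.
by rewrite og ?mulr0 //; rewrite md in mab; lia.
Qed.

Lemma order_ge_mull (N : nat) (f g : pseries) :
  order_ge N g -> order_ge N (f * g).
Proof. exact: (order_geM (@order_ge0 f)). Qed.

Lemma order_ge1_var (u : letter) : order_ge 1 (var u).
Proof.
move=> m; rewrite ltnS leqn0 => /eqP m0.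
rewrite /var /=; case: eqP => // mu; move: m0.
by rewrite mu mdegU.
Qed.

Lemma order_ge_varX (u : letter) (k : nat) : order_ge k (var u ^+ k).
Proof.
elim: k => [//|k IH]; rewrite exprS -add1n.
exact: order_geM (@order_ge1_var u) IH.
Qed.

Lemma order_ge_eq (f g : pseries) :
  (forall N, order_ge N (f - g)) -> f = g.
Proof.
move=> ofg; apply: fpsP => m.
have := ofg (mdeg m).+1 m (ltnSn _).
by rewrite fcoefB => /eqP; rewrite subr_eq0 => /eqP.
Qed.

(* The topology of order is separated, so a contraction has a unique fixed point. *)
Lemma order_fix (f g : pseries) : order_ge 1 g -> f = g * f -> f = 0.
Proof.
move=> og fgf; apply: order_ge_eq; rewrite subr0.
elim=> [|N IH]; first exact: order_ge0.
by rewrite fgf -add1n; exact: order_geM.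
Qed.

Lemma fcoef_sum (M : Type) (R : zmodType) (I : Type) (L : seq I) (P : pred I)
    (F : I -> fps M R) (m : M) :
  fcoef (\sum_(i <- L | P i) F i) m = \sum_(i <- L | P i) fcoef (F i) m.
Proof. exact: (big_morph (fun f => fcoef f m)). Qed.

Lemma fps_sum_seq (I : choiceType) (A : set I) (F : I -> pseries) (N : nat)
    (L : seq I) :
    uniq L -> (forall i, i \in L -> A i) ->
    (forall i, A i -> i \notin L -> order_ge N (F i)) ->
  order_ge N (fps_sum A F - \sum_(i <- L) F i).
Proof.
move=> uL LA AL m mN; rewrite fcoefB fcoef_sum /=.
rewrite (@fsbigE _ _ _ _ A L) // => [|i Ai iL]; last exact: AL.
apply/eqP; rewrite subr_eq0 big_mkcond /= big_seq [eqbRHS]big_seq.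
by apply/eqP/eq_bigr => i iL; rewrite mem_set //; exact: LA.
Qed.

Definition summable (I : choiceType) (A : set I) (F : I -> pseries) : Prop :=
  forall N, finite_set [set i | A i /\ ~ order_ge N (F i)].

Lemma summableW (I : choiceType) (A B : set I) (F : I -> pseries) :
  B `<=` A -> summable A F -> summable B F.
Proof.
move=> BA sA N; apply: sub_finite_set (sA N) => i [Bi oi]; split=> //.
exact: BA.
Qed.

Lemma summable_seq (I : choiceType) (A : set I) (F : I -> pseries) (N : nat) :
  summable A F ->
  exists L : seq I, [/\ uniq L, forall i, i \in L -> A i
    & forall i, A i -> i \notin L -> order_ge N (F i)].
Proof.
move=> sA; exists (fset_set [set i | A i /\ ~ order_ge N (F i)]); split.
- exact: fset_uniq.
- by move=> i; rewrite in_fset_set // inE => -[].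
- move=> i Ai; rewrite in_fset_set // notin_setE /= => nF.
  by apply: contrapT => oF; apply: nF.
Qed.

Lemma fps_sumM (I : choiceType) (A : set I) (F : I -> pseries) (c : pseries) :
  summable A F -> fps_sum A (fun i => c * F i) = c * fps_sum A F.
Proof.
move=> sA; apply: order_ge_eq => N.
have [L [uL LA AL]] := summable_seq N sA.
have -> : fps_sum A (fun i => c * F i) - c * fps_sum A F =
    (fps_sum A (fun i => c * F i) - \sum_(i <- L) c * F i)
    - c * (fps_sum A F - \sum_(i <- L) F i).
  by rewrite mulrBr mulr_sumr; ring.
apply: order_geB.
  apply: fps_sum_seq => // i Ai iL; apply: order_ge_mull; exact: AL.
apply: order_ge_mull; exact: fps_sum_seq.
Qed.

Lemma fps_sumU (I : choiceType) (A B : set I) (F : I -> pseries) :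
  summable A F -> summable B F -> (forall i, A i -> ~ B i) ->
  fps_sum (A `|` B) F = fps_sum A F + fps_sum B F.
Proof.
move=> sA sB AB; apply: order_ge_eq => N.
have [L [uL LA AL]] := summable_seq N sA.
have [L' [uL' LB BL]] := summable_seq N sB.
have -> : fps_sum (A `|` B) F - (fps_sum A F + fps_sum B F) =
    (fps_sum (A `|` B) F - \sum_(i <- L ++ L') F i)
    - (fps_sum A F - \sum_(i <- L) F i)
    - (fps_sum B F - \sum_(i <- L') F i).
  by rewrite big_cat /=; ring.
apply: order_geB; last exact: fps_sum_seq.
apply: order_geB; last exact: fps_sum_seq.
apply: fps_sum_seq.
- rewrite cat_uniq uL uL' andbT /=; apply/hasPn => i iL'.
  by apply/negP => iL; exact: AB (LA _ iL) (LB _ iL').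
- by move=> i; rewrite mem_cat => /orP[/LA|/LB]; [left|right].
- by move=> i Ui; rewrite mem_cat negb_or => /andP[iL iL']; case: Ui; auto.
Qed.

Lemma fps_sum_image (I J : choiceType) (A : set I) (h : I -> J)
    (F : J -> pseries) :
  injective h -> fps_sum (h @` A) F = fps_sum A (F \o h).
Proof.
move=> ih; apply: fpsP => m /=; rewrite fsbig_image //.
by move=> ? ? _ _; exact: ih.
Qed.

Lemma eq_fps_sum (I : choiceType) (A : set I) (F G : I -> pseries) :
  (forall i, A i -> F i = G i) -> fps_sum A F = fps_sum A G.
Proof.
move=> FG; apply: fpsP => m /=; apply: eq_fsbigr => i iA.
by rewrite FG //; exact: set_mem.
Qed.

Lemma fps_sum_set1 (I : choiceType) (i : I) (F : I -> pseries) :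
  fps_sum [set i] F = F i.
Proof. by apply: fpsP => m /=; rewrite fsbig_set1. Qed.

Lemma fps_sum_set0 (I : choiceType) (F : I -> pseries) :
  fps_sum set0 F = 0.
Proof. by apply: fpsP => m /=; rewrite fsbig_set0. Qed.

(** * Complete homogeneous series *)

Lemma hgenEw (Z : lincomb) (D : {fset letter}) : (msupp Z `<=` D)%fset ->
  hgen Z = \prod_(u <- D) (1 - fps_mono 1%N (var u)) ^ (- Z@_u).
Proof.
move=> ZD; rewrite /hgen (big_fset_incl _ ZD) // => u _ uZ.
by rewrite mcoeff_outdom ?oppr0.
Qed.

Lemma hgenDU (Z : lincomb) (u : letter) :
  hgen (Z + << u >>) * (1 - fps_mono 1%N (var u)) = hgen Z.
Proof.
have [D [ZD ZuD uD]] : exists D : {fset letter},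
    [/\ (msupp Z `<=` D)%fset, (msupp (Z + << u >>) `<=` D)%fset & u \in D].
  exists (msupp Z `|` [fset u])%fset; split; first exact: fsubsetUl.
    by apply: fsubset_trans (msuppD_le _ _) _; exact: fsetUS msuppU_le.
  by rewrite in_fsetU in_fset1 eqxx orbT.
rewrite (hgenEw ZD) (hgenEw ZuD) (big_fsetD1 u uD) [RHS](big_fsetD1 u uD).
have -> : \prod_(v <- (D `\ u)%fset)
      (1 - fps_mono 1%N (var v)) ^ (- (Z + << u >>)@_v) =
    \prod_(v <- (D `\ u)%fset) (1 - fps_mono 1%N (var v)) ^ (- Z@_v).
  apply: eq_fbigr => v; rewrite in_fsetD1 => /andP[vu _] _.
  by rewrite mcoeffD mcoeffU eq_sym (negPf vu) mulr0n addr0.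
rewrite mulrAC -[X in _ * X * _]expr1z -exprzDr ?unit_1subt //.
by rewrite mcoeffD mcoeffUU opprD subrK.
Qed.

Lemma hgen0 : hgen 0 = 1.
Proof. by rewrite /hgen msupp0 big_seq_fset0. Qed.

Section MulOneSubT.
Variables (S : comNzRingType) (f : fps nat S) (c : S).

Lemma fcoef_mul_1subt0 : fcoef (f * (1 - fps_mono 1%N c)) 0%N = fcoef f 0%N.
Proof.
rewrite mulrBr (mulr1 f) fcoefB fcoefM [X in _ - X]fsbig1 ?subr0 //.
move=> [a [|b]] /= ab; first by rewrite mulr0n mulr0.
by rewrite /mmul /= in ab; lia.
Qed.

Lemma fcoef_mul_1subtS (k : nat) :
  fcoef (f * (1 - fps_mono 1%N c)) k.+1 = fcoef f k.+1 - c * fcoef f k.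
Proof.
rewrite mulrBr (mulr1 f) fcoefB; congr (_ - _); rewrite mulrC.
apply: (@fps_mono_mulE nat S 1%N c f k k.+1) => //.
by move=> j; exact: succn_inj.
Qed.

End MulOneSubT.

Lemma hcompl_0 (m : nat) : hcompl m 0 = (m == 0%N)%:R.
Proof. by rewrite /hcompl hgen0. Qed.

Lemma hcompl0DU (Z : lincomb) (u : letter) :
  hcompl 0 (Z + << u >>) = hcompl 0 Z.
Proof.
have := congr1 (fun f => fcoef f 0%N) (hgenDU Z u).
by rewrite fcoef_mul_1subt0.
Qed.

Lemma hcomplSDU (k : nat) (Z : lincomb) (u : letter) :
  hcompl k.+1 (Z + << u >>) = hcompl k.+1 Z + var u * hcompl k (Z + << u >>).
Proof.
have := congr1 (fun f => fcoef f k.+1) (hgenDU Z u).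
rewrite fcoef_mul_1subtS => E; apply/eqP; rewrite -subr_eq; apply/eqP.
exact: E.
Qed.

Definition graded (f : fps nat pseries) : Prop :=
  forall k, order_ge k (fcoef f k).

Lemma graded1 : graded 1.
Proof. by case=> [|k]; rewrite fcoef1; [exact: order_ge0|exact: order_ge_0]. Qed.

Lemma gradedM (f g : fps nat pseries) : graded f -> graded g -> graded (f * g).
Proof.
move=> gf gg k; have [L Lk] := factors_ex k.
have -> : fcoef (f * g) k = fcoef (fps_mul f g) k by [].
rewrite (fps_mulE _ _ Lk); apply: order_ge_sum => a _.
apply: order_ge_sum => b _; case: eqP => [<-|_]; last exact: order_ge_0.
by rewrite mulr1n; exact: order_geM.
Qed.

Lemma graded_1subt (u : letter) : graded (1 - fps_mono 1%N (var u)).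
Proof.
move=> k; rewrite fcoefB.
apply: order_geB; first exact: graded1.
rewrite /fps_mono.
case: k => [|[|k]].
- exact: order_ge0.
- by move=> m mm; apply: (@order_ge1_var u m mm).
- exact: order_ge_0.
Qed.

Lemma graded_1subtV (u : letter) : graded (1 - fps_mono 1%N (var u))^-1.
Proof.
suff -> : (1 - fps_mono 1%N (var u))^-1 = FPS (fun k : nat => var u ^+ k).
  by move=> k; exact: order_ge_varX.
apply: (mulIr (unit_1subt (var u))).
by rewrite mulVr ?unit_1subt // fps_geomP.
Qed.

Lemma gradedX (f : fps nat pseries) (k : nat) : graded f -> graded (f ^+ k).
Proof.
move=> gf; elim: k => [|k IH]; first exact: graded1.
by rewrite exprS; exact: gradedM.
Qed.

Lemma order_hcompl (Z : lincomb) (k : nat) : order_ge k (hcompl k Z).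
Proof.
suff gZ : graded (hgen Z) by exact: gZ.
rewrite /hgen; elim/big_ind: _ => [||u _]; [exact: graded1|exact: gradedM|].
case: (- Z@_u) => j; first by apply: gradedX; exact: graded_1subt.
by rewrite NegzE -exprz_inv; apply: gradedX; exact: graded_1subtV.
Qed.

Definition hz (m : int) (Z : lincomb) : pseries :=
  if m is Posz k then hcompl k Z else 0.

Lemma hzDU (m : int) (Z : lincomb) (u : letter) :
  hz m (Z + << u >>) = hz m Z + var u * hz (m - 1) (Z + << u >>).
Proof.
case: m => [[|k]|k].
- by rewrite /= hcompl0DU mulr0 addr0.
- have -> : k.+1%:Z - 1 = k by lia.
  exact: hcomplSDU.
- have -> : Negz k - 1 = Negz k.+1 by lia.
  by rewrite /= mulr0 addr0.
Qed.

Lemma h_ominus_trunc (m : int) (Y W : lincomb) (N K : nat) : (N <= K)%N ->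
  order_ge N (h_ominus m Y W - \sum_(b < K) hz (m + b%:Z) Y * hcompl b W).
Proof.
move=> NK.
pose f (b : nat) := (absz (m + b%:Z), b).
pose L := [seq f b | b <- iota 0 K & 0 <= m + b%:Z].
have -> : \sum_(b < K) hz (m + b%:Z) Y * hcompl b W =
    \sum_(p <- L) hcompl p.1 Y * hcompl p.2 W.
  rewrite /L big_map big_filter -(big_mkord xpredT
    (fun b : nat => hz (m + b%:Z) Y * hcompl b W)) /index_iota subn0.
  rewrite [RHS]big_mkcond; apply: eq_bigr => b _ /=.
  by case: (m + b%:Z) => k //=; rewrite mul0r.
apply: fps_sum_seq.
- rewrite map_inj_uniq ?filter_uniq ?iota_uniq // => a b.
  by case.
- by move=> p /mapP[b]; rewrite mem_filter => /andP[mb _] -> /=; lia.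
- move=> [a b] /= abm abL; apply: order_ge_mull.
  apply: (order_geW _ (@order_hcompl W b)); apply: leq_trans NK _.
  rewrite leqNgt; apply/negP => bK; move/negP: abL; apply.
  apply/mapP; exists b; last by rewrite /f -abm; congr pair; lia.
  by rewrite mem_filter mem_iota -abm; apply/andP; split; lia.
Qed.

Lemma h_ominusDl (m : int) (Y W : lincomb) (u : letter) :
  h_ominus m (Y + << u >>) W =
  h_ominus m Y W + var u * h_ominus (m - 1) (Y + << u >>) W.
Proof.
apply: order_ge_eq => N.
have t1 := @h_ominus_trunc m (Y + << u >>) W N N (leqnn N).
have t2 := @h_ominus_trunc m Y W N N (leqnn N).
have t3 := @h_ominus_trunc (m - 1) (Y + << u >>) W N N (leqnn N).
have := order_geB (order_geB t1 t2) (order_ge_mull (var u) t3).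
set s1 := \sum_(b < N) _; set s2 := \sum_(b < N) _; set s3 := \sum_(b < N) _.
have -> : s1 = s2 + var u * s3; last by congr order_ge; ring.
rewrite mulr_sumr -big_split; apply: eq_bigr => b _ /=.
rewrite hzDU mulrDl -mulrA.
by have -> : m + b%:Z - 1 = m - 1 + b%:Z by lia.
Qed.

Lemma h_ominusDr (m : int) (Y W : lincomb) (u : letter) :
  h_ominus m Y (W + << u >>) =
  h_ominus m Y W + var u * h_ominus (m + 1) Y (W + << u >>).
Proof.
apply: order_ge_eq => N.
have t1 := @h_ominus_trunc m Y (W + << u >>) N N.+1 (leqnSn N).
have t2 := @h_ominus_trunc m Y W N N.+1 (leqnSn N).
have t3 := @h_ominus_trunc (m + 1) Y (W + << u >>) N N (leqnn N).
have := order_geB (order_geB t1 t2) (order_ge_mull (var u) t3).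
set s1 := \sum_(b < _) _; set s2 := \sum_(b < _) _; set s3 := \sum_(b < _) _.
have -> : s1 = s2 + var u * s3; last by congr order_ge; ring.
rewrite /s1 /s2 !big_ord_recl hcompl0DU -addrA; congr (_ + _).
rewrite mulr_sumr -big_split; apply: eq_bigr => b _ /=.
rewrite hcomplSDU mulrDr mulrCA.
by have -> : m + (lift ord0 b)%:Z = m + 1 + b%:Z by rewrite lift0; lia.
Qed.

(* Elements of [L] count with coefficient -1, so that [hgen] is a polynomial of
   degree [size L]. *)
Lemma hcompl_sumN (L : seq letter) (b : nat) : (size L < b)%N ->
  hcompl b (- \sum_(u <- L) << u >>) = 0.
Proof.
elim: L b => [|u L IH] [//|b].
  by rewrite big_nil oppr0 hcompl_0.
rewrite /= ltnS => Lb; rewrite big_cons opprD addrC.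
set Z := - _ - _; have ZE : Z + << u >> = - \sum_(v <- L) << v >>.
  by rewrite /Z subrK.
have := hcomplSDU b Z u; rewrite ZE !IH ?mulr0 ?addr0 //.
exact: ltnW.
Qed.

Lemma h_ominus_sumN (m : int) (Y : lincomb) (L : seq letter) :
  m + (size L)%:Z < 0 -> h_ominus m Y (- \sum_(u <- L) << u >>) = 0.
Proof.
move=> mL; apply: order_ge_eq => N; rewrite subr0.
have := @h_ominus_trunc m Y (- \sum_(u <- L) << u >>) N N (leqnn N).
rewrite [X in _ - X]big1 ?subr0 => [|b _]; first by [].
have [bL|Lb] := leqP b (size L); last by rewrite hcompl_sumN ?mulr0.
case E: (m + b%:Z) => [j|j] /=; last by rewrite mul0r.
by exfalso; lia.
Qed.

Lemma h_ominus0_pos (m : int) (W : lincomb) : 0 < m -> h_ominus m 0 W = 0.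
Proof.
move=> m0; apply: order_ge_eq => N; rewrite subr0.
have := @h_ominus_trunc m 0 W N N (leqnn N).
rewrite [X in _ - X]big1 ?subr0 => [|b _]; first by [].
case E: (m + b%:Z) => [[|j]|j] /=; rewrite ?hcompl_0 ?mul0r //.
by lia.
Qed.

Lemma h_ominus00_U (u : letter) : h_ominus 0 0 << u >> = 1.
Proof.
apply: order_ge_eq => N.
have := @h_ominus_trunc 0 0 << u >> N N.+1 (leqnSn N).
rewrite big_ord_recl big1 ?addr0 /= => [|b _]; last first.
  by rewrite hcompl_0 mul0r.
by rewrite hcompl_0 mul1r -[<< u >>]add0r hcompl0DU hcompl_0.
Qed.

Lemma h_ominus0_U (L : seq letter) (u : letter) :
  (\prod_(v <- L) (1 - var u * var v)) *
    h_ominus 0 (\sum_(v <- L) << v >>) << u >> = 1.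
Proof.
elim: L => [|v L IH]; first by rewrite !big_nil mul1r h_ominus00_U.
rewrite !big_cons [<< v >> + _]addrC.
move: IH; set Y := \sum_(w <- L) << w >>; set P := \prod_(w <- L) _ => IH.
have neg : h_ominus (0 - 1) (Y + << v >>) 0 = 0.
  have := @h_ominus_sumN (0 - 1) (Y + << v >>) [::].
  by rewrite big_nil oppr0; apply.
have := h_ominusDr (0 - 1) (Y + << v >>) 0 u.
have := h_ominusDl 0 Y << u >> v.
rewrite neg subrK !add0r => E1 E2; rewrite -[RHS]IH.
have elim_h1 (R : comNzRingType) (a b p h h0 h1 : R) :
    h = h0 + b * h1 -> h1 = a * h -> (1 - a * b) * p * h = p * h0.
  move=> hE h1E; have -> : h0 = h - b * (a * h) by rewrite -h1E hE addrK.
  by ring.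
exact: elim_h1 E1 E2.
Qed.

(** * The determinant *)

Lemma h_ominus_step (u x : letter) (m : int) (Y Y' W W' : lincomb) :
    Y = Y' + << x >> \/ Y = Y' /\ h_ominus (m - 1) Y W = 0 ->
    W = W' + << u >> ->
  (1 - var u * var x) * h_ominus m Y W =
  h_ominus m Y' W + var x * h_ominus (m - 1) Y W'.
Proof.
move=> YY' WW'.
have := h_ominusDr (m - 1) Y W' u; rewrite subrK -WW'.
have solve_h1 (R : comNzRingType) (a b h h' k k' : R) :
    h = h' + b * k \/ h = h' /\ k = 0 -> k = k' + a * h ->
    (1 - a * b) * h = h' + b * k'.
  move=> hh' kE; have -> : k' = k - a * h by rewrite kE addrK.
  case: hh' => [hE|[-> ->]]; last by ring.
  by have -> : h' = h - b * k by [rewrite hE addrK]; ring.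
apply: solve_h1; case: YY' => [->|[-> E]]; last by right.
by left; exact: h_ominusDl.
Qed.

Lemma alphas_sub (a b : nat) : (a <= b)%N ->
  alphas a - alphas b = - \sum_(u <- [seq Al l | l <- index_iota a.+1 b.+1]) << u >>.
Proof.
move=> ab; rewrite big_map /alphas.
by rewrite (big_cat_nat (n := a.+1) (p := b.+1)) //= opprD addrA subrr add0r.
Qed.

Lemma betas_sub (a b : nat) : (a <= b)%N ->
  betas a - betas b = - \sum_(u <- [seq Be l | l <- index_iota a.+1 b.+1]) << u >>.
Proof.
move=> ab; rewrite big_map /betas.
by rewrite (big_cat_nat (n := a.+1) (p := b.+1)) //= opprD addrA subrr add0r.
Qed.

Lemma alphasS (a : nat) : alphas a.+1 = alphas a + << Al a.+1 >>.
Proof. by rewrite /alphas big_nat_recr. Qed.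

Lemma betasS (a : nat) : betas a.+1 = betas a + << Be a.+1 >>.
Proof. by rewrite /betas big_nat_recr. Qed.

Lemma xsS (a b : nat) : (a <= b.+1)%N -> xs a b.+1 = xs a b + << Xl b.+1 >>.
Proof. by move=> ab; rewrite /xs big_nat_recr. Qed.

Lemma xs_geq (a b : nat) : (b < a)%N -> xs a b = 0.
Proof. by move=> ba; rewrite /xs big_geq. Qed.

Lemma det_row_comb (R : comNzRingType) (n : nat) (A B C : 'M[R]_n) (i : 'I_n)
    (a c : R) :
    (forall j, a * A i j = B i j + c * C i j) ->
    (forall k j, k != i -> B k j = A k j) ->
    (forall k j, k != i -> C k j = A k j) ->
  a * \det A = \det B + c * \det C.
Proof.
move=> rowi rowB rowC.
have cof (D : 'M[R]_n) (j : 'I_n) : (forall k j, k != i -> D k j = A k j) ->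
    cofactor D i j = cofactor A i j.
  move=> DA; rewrite /cofactor; congr (_ * \det _).
  by apply/matrixP => k l; rewrite !mxE DA // eq_sym neq_lift.
rewrite !(expand_det_row _ i) !mulr_sumr -big_split; apply: eq_bigr => j _ /=.
rewrite (cof B) // (cof C) //; move: (cofactor A i j) => d.
by rewrite !mulrA rowi mulrDl.
Qed.

(* A permutation cannot map [S] into itself minus a point. *)
Lemma det_zero_block (R : comNzRingType) (n : nat) (A : 'M[R]_n) (S : {set 'I_n})
    (i : 'I_n) :
    i \in S ->
    (forall p q, p \in S -> (q == i) || (q \notin S) -> A p q = 0) ->
  \det A = 0.
Proof.
move=> iS A0; apply: big1 => sg _.
suff [p pS q0] : exists2 p, p \in S & (sg p == i) || (sg p \notin S).
  by rewrite (bigD1 p) //= A0 // mul0r mulr0.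
apply/exists_inP; apply: contraT => /exists_inPn no.
have : (#|(sg @: S)%SET| <= #|(S :\ i)%SET|)%N.
  apply: subset_leq_card; apply/fintype.subsetP => _ /imsetP[p pS ->].
  by have := no p pS; rewrite negb_or negbK !inE.
by rewrite card_imset; [rewrite [#|S|](cardsD1 i) iS ltnn|exact: perm_inj].
Qed.

Definition dec (n : nat) (f : 'I_n -> nat) (i k : 'I_n) : nat :=
  (f k - (k == i))%N.

Lemma dec_id (n : nat) (f : 'I_n -> nat) (i : 'I_n) : dec f i i = (f i).-1.
Proof. by rewrite /dec eqxx subn1. Qed.

Lemma dec_neq (n : nat) (f : 'I_n -> nat) (i k : 'I_n) :
  k != i -> dec f i k = f k.
Proof. by move=> /negPf ki; rewrite /dec ki subn0. Qed.

Lemma dec_le (n : nat) (f : 'I_n -> nat) (i k : 'I_n) : (dec f i k <= f k)%N.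
Proof. exact: leq_subr. Qed.

Definition overlap_mono (n : nat) (lam mu r s : 'I_n -> nat) : Prop :=
  forall i i' : 'I_n, i' = i.+1 :> nat -> (mu i < lam i')%N ->
    (r i <= r i')%N /\ (s i <= s i')%N.

Definition jt_entry (n : nat) (lam mu r s : 'I_n -> nat) (i j : 'I_n) : pseries :=
  h_ominus ((lam i)%:Z - (mu j)%:Z - i%:Z + j%:Z) (xs (r j) (s i))
    (alphas (lam i) - alphas (mu j) - betas i + betas j.+1).

Definition jt_det (n : nat) (lam mu r s : 'I_n -> nat) : pseries :=
  \det (\matrix_(i < n, j < n) jt_entry lam mu r s i j).

Section JacobiTrudiEntries.
Variables (n : nat) (lam mu r s : 'I_n -> nat).
Hypothesis lam_part : is_partition lam.
Hypothesis mu_part : is_partition mu.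

Lemma h_ominus_below (i j : 'I_n) (m : int) (Y : lincomb) :
    (j < i)%N -> (lam i <= mu j)%N ->
    m <= (lam i)%:Z - (mu j)%:Z - i%:Z + j%:Z ->
  h_ominus m Y (alphas (lam i) - alphas (mu j) - betas i + betas j.+1) = 0.
Proof.
move=> ji lm mle.
have -> : alphas (lam i) - alphas (mu j) - betas i + betas j.+1 =
    (alphas (lam i) - alphas (mu j)) + (betas j.+1 - betas i).
  by rewrite [betas _ - _]addrC addrA.
rewrite alphas_sub // betas_sub // -opprD -big_cat; apply: h_ominus_sumN.
by rewrite size_cat !size_map /index_iota !size_iota; lia.
Qed.

Definition linked (j i : 'I_n) : Prop :=
  forall k k' : 'I_n, k' = k.+1 :> nat -> (j <= k)%N -> (k' <= i)%N ->
    (mu k < lam k')%N.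

Lemma linked_lt (j i : 'I_n) : (mu j < lam i)%N -> linked j i.
Proof.
move=> ml k k' kk' jk ki.
by apply: leq_ltn_trans (mu_part jk) _; apply: leq_trans ml (lam_part ki).
Qed.

Lemma linked_trans (i j k : 'I_n) : linked i j -> linked j k -> linked i k.
Proof.
move=> lij ljk p p' pp' ip pk; have [p'j|jp'] := leqP p' j; first exact: lij.
by apply: ljk => //; rewrite pp' in jp'.
Qed.

Lemma linked_sub (i j p q : 'I_n) :
  linked i j -> (i <= p)%N -> (q <= j)%N -> linked p q.
Proof. by move=> lij ip qj k k' kk' pk k'q; apply: lij => //; lia. Qed.

Lemma not_linked_le (i j : 'I_n) : ~ linked i j -> (lam j <= mu i)%N.
Proof. by move=> nl; rewrite leqNgt; apply/negP => /linked_lt. Qed.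

Lemma linked_mono (j i : 'I_n) : overlap_mono lam mu r s ->
  (j <= i)%N -> linked j i -> (r j <= r i)%N /\ (s j <= s i)%N.
Proof.
move=> rs; case: i => i; elim: i => [|i IH] ni ji lji.
  by have -> : j = Ordinal ni by [apply: val_inj => /=; rewrite /= in ji; lia].
have [ji'|] := ltnP j i.+1; last first.
  by move=> ij; have -> : j = Ordinal ni by [apply: val_inj => /=; rewrite /= in ji; lia].
have ni' : (i < n)%N by exact: ltnW.
have [r1 s1] : (r j <= r (Ordinal ni'))%N /\ (s j <= s (Ordinal ni'))%N.
  by apply: IH => //; apply: (linked_sub lji) => /=.
have [r2 s2] : (r (Ordinal ni') <= r (Ordinal ni))%N /\
    (s (Ordinal ni') <= s (Ordinal ni))%N.
  by apply: rs => //; apply: lji.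
by split; [exact: leq_trans r2|exact: leq_trans s2].
Qed.

Lemma h_ominus_pred_vanish (i j : 'I_n) : overlap_mono lam mu r s ->
    (mu i < lam i)%N -> (r i <= s i)%N -> (s i < r j)%N ->
  h_ominus ((lam i)%:Z - (mu j)%:Z - i%:Z + j%:Z - 1) (xs (r j) (s i))
    (alphas (lam i) - alphas (mu j) - betas i + betas j.+1) = 0.
Proof.
move=> rs mli ri sr; have [ij|ji|/val_inj ij] := ltngtP i j.
- rewrite xs_geq //; apply: h_ominus0_pos.
  have := mu_part (ltnW ij); lia.
- have [lm|ml] := leqP (lam i) (mu j).
    by apply: h_ominus_below => //; lia.
  have [rji _] := linked_mono rs (ltnW ji) (linked_lt ml); lia.
- by rewrite -ij in sr; lia.
Qed.

Lemma jt_row_step (i j : 'I_n) (u : letter) (W : lincomb) :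
    overlap_mono lam mu r s -> (0 < r i)%N ->
    (mu i < lam i)%N -> (r i <= s i)%N ->
    alphas (lam i) - alphas (mu j) - betas i + betas j.+1 = W + << u >> ->
  (1 - var u * var (Xl (s i))) * jt_entry lam mu r s i j =
  jt_entry lam mu r (dec s i) i j + var (Xl (s i)) *
    h_ominus ((lam i)%:Z - (mu j)%:Z - i%:Z + j%:Z - 1) (xs (r j) (s i)) W.
Proof.
move=> rs r0 mli ri WE; rewrite /jt_entry dec_id.
apply: h_ominus_step => //.
have [rj|sr] := leqP (r j) (s i).
  have [t st] : exists t, s i = t.+1 by exists (s i).-1; lia.
  by left; rewrite st; apply: xsS; rewrite -st.
right; split; last exact: h_ominus_pred_vanish.
by rewrite !xs_geq //; lia.
Qed.

Lemma jt_det_corner (i : 'I_n) :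
    overlap_mono lam mu r s -> (0 < r i)%N ->
    (mu i < lam i)%N -> (r i <= s i)%N ->
  (1 - var (Al (lam i)) * var (Xl (s i))) * jt_det lam mu r s =
  jt_det lam mu r (dec s i) + var (Xl (s i)) * jt_det (dec lam i) mu r s.
Proof.
move=> rs r0 mli ri.
apply: (det_row_comb (i := i)) => [j|k j ki|k j ki]; rewrite !mxE.
- have [l lE] : exists l, lam i = l.+1 by exists (lam i).-1; lia.
  have -> : jt_entry (dec lam i) mu r s i j =
      h_ominus ((lam i)%:Z - (mu j)%:Z - i%:Z + j%:Z - 1) (xs (r j) (s i))
        (alphas (lam i).-1 - alphas (mu j) - betas i + betas j.+1).
    by rewrite /jt_entry dec_id; congr h_ominus; lia.
  apply: jt_row_step => //; rewrite lE /= alphasS.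
  do 2![rewrite [RHS]addrAC; congr (_ + _)]; exact: addrAC.
- by rewrite /jt_entry dec_neq.
- by rewrite /jt_entry dec_neq.
Qed.

Lemma jt_det_equal_rows (i i' : 'I_n) :
    overlap_mono lam mu r s -> (0 < r i)%N ->
    (mu i < lam i)%N -> (r i <= s i)%N ->
    i' = i.+1 :> nat -> lam i' = lam i -> s i' = s i ->
  jt_det lam mu r (dec s i) =
  (1 - var (Be i.+1) * var (Xl (s i))) * jt_det lam mu r s.
Proof.
move=> rs r0 mli ri ii' ll ss.
pose C : 'M[pseries]_n :=
  \matrix_(k, j) jt_entry lam mu r s (if k == i then i' else k) j.
have i'i : i' != i by apply/eqP => /(congr1 val) /=; lia.
have C0 : \det C = 0.
  apply: (@determinant_alternate _ _ _ i i'); first by rewrite eq_sym.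
  by move=> j; rewrite !mxE eqxx (negPf i'i).
rewrite -[LHS]addr0 -[X in _ + X](mulr0 (var (Xl (s i)))) -C0.
apply/esym.
apply: (det_row_comb (i := i)) => [j|k j ki|k j ki]; rewrite !mxE.
- rewrite eqxx.
  have -> : jt_entry lam mu r s i' j =
      h_ominus ((lam i)%:Z - (mu j)%:Z - i%:Z + j%:Z - 1) (xs (r j) (s i))
        (alphas (lam i) - alphas (mu j) - betas i.+1 + betas j.+1).
    by rewrite /jt_entry ll ss ii'; congr h_ominus; lia.
  apply: jt_row_step => //.
  by rewrite (betasS i) opprD addrA [RHS]addrAC subrK.
- by rewrite /jt_entry dec_neq.
- by rewrite (negPf ki).
Qed.

Lemma jt_det_empty_flag (i : 'I_n) :
    overlap_mono lam mu r s -> (mu i < lam i)%N -> (s i < r i)%N ->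
  jt_det lam mu r s = 0.
Proof.
move=> rs mli sr.
pose up (p : 'I_n) := (p <= i)%N && `[< linked p i >].
pose down (p : 'I_n) := (i < p)%N && ~~ `[< linked i p >].
apply: (@det_zero_block _ _ _ [set p | up p || down p]%SET i).
  rewrite inE /up leqnn /=; apply/orP; left; apply/asboolP.
  exact: linked_lt.
move=> p q; rewrite !inE mxE => pS qS.
have below : (q < p)%N -> ~ linked q p -> jt_entry lam mu r s p q = 0.
  by move=> qp nl; apply: h_ominus_below => //; exact: not_linked_le.
have [[iq liq]|[qi nqi]] : (i <= q)%N /\ linked i q \/ (q < i)%N /\ ~ linked q i.
  have [qi|iq] := ltnP q i.
    right; split=> // lqi; case/orP: qS => [/eqP qi'|].
      by rewrite qi' ltnn in qi.
    by rewrite /up ltnW //= negb_or => /andP[/negP]; case; apply/asboolP.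
  left; split=> //; case/orP: qS => [/eqP ->|]; first exact: linked_lt.
  rewrite negb_or /down => /andP[upq]; rewrite negb_and negbK.
  move=> /orP[|/asboolP //]; rewrite -leqNgt => qi.
  have -> : q = i by apply: val_inj => /=; lia.
  exact: linked_lt.
- case/orP: pS => /andP[pi].
    move=> /asboolP lpi.
    have [_ sp] := linked_mono rs pi lpi; have [rq _] := linked_mono rs iq liq.
    rewrite /jt_entry xs_geq; last by lia.
    apply: h_ominus0_pos; have := lam_part pi; have := mu_part iq.
    by lia.
  move=> /asboolPn nip.
  have [pq|qp] := leqP p q; last first.
    by apply: below => // lqp; apply: nip; exact: linked_trans lqp.
  by case: nip; apply: (linked_sub liq).
- case/orP: pS => /andP[pi].
    move=> /asboolP lpi; have [pq|qp] := leqP p q.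
      by case: nqi; apply: (linked_sub lpi).
    by apply: below => // lqp; apply: nqi; exact: linked_trans lqp lpi.
  move=> _; apply: below; first by lia.
  by move=> lqp; apply: nqi; apply: (linked_sub lqp) => //; lia.
Qed.

End JacobiTrudiEntries.

Definition row_factor (n : nat) (r s : 'I_n -> nat) (i : 'I_n) : pseries :=
  \prod_(r i <= l < (s i).+1) (1 - var (Be i.+1) * var (Xl l)).

Definition flag_factor (n : nat) (r s : 'I_n -> nat) : pseries :=
  \prod_(i < n) row_factor r s i.

Lemma flag_factor_dec (n : nat) (r s : 'I_n -> nat) (i : 'I_n) :
  (0 < r i <= s i)%N ->
  flag_factor r s =
  (1 - var (Be i.+1) * var (Xl (s i))) * flag_factor r (dec s i).
Proof.
move=> /andP[r0 rs].
have rowi : row_factor r s i =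
    (1 - var (Be i.+1) * var (Xl (s i))) * row_factor r (dec s i) i.
  have last_out (R : comNzRingType) (f : nat -> R) (a b : nat) : (a <= b)%N ->
      \prod_(a <= l < b.+1) f l = f b * \prod_(a <= l < b) f l.
    by move=> ab; rewrite big_nat_recr //= mulrC.
  rewrite /row_factor dec_id prednK; last by lia.
  by rewrite last_out.
have rows : \prod_(k < n | k != i) row_factor r s k =
    \prod_(k < n | k != i) row_factor r (dec s i) k.
  by apply: eq_bigr => k ki; rewrite /row_factor dec_neq.
by rewrite /flag_factor (bigD1 i) // [X in _ = _ * X](bigD1 i) // rowi rows mulrA.
Qed.

Lemma jt_det_refl (n : nat) (lam mu r s : 'I_n -> nat) :
  is_partition mu -> lam =1 mu -> flag_factor r s * jt_det lam mu r s = 1.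
Proof.
move=> mu_part /funext ->; rewrite /jt_det -det_tr det_trig; last first.
  apply/is_trig_mxP => j i ji; rewrite !mxE; apply: h_ominus_below => //.
  exact: mu_part (ltnW ji).
rewrite /flag_factor -big_split; apply: big1 => i _ /=; rewrite !mxE.
have -> : jt_entry mu mu r s i i = h_ominus 0 (xs (r i) (s i)) << Be i.+1 >>.
  rewrite /jt_entry subrr sub0r addNr; congr h_ominus.
  by rewrite subrr betasS sub0r addrA addNr add0r.
have := h_ominus0_U [seq Xl l | l <- index_iota (r i) (s i).+1] (Be i.+1).
by rewrite 2!big_map.
Qed.

(** * Tableaux *)

Lemma path_leq_last (a : nat) (L : seq nat) :
  path leq a L -> all (fun b => b <= last a L)%N (a :: L).
Proof.
elim: L a => [|b L IH] a /=; first by rewrite leqnn.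
by move=> /andP[ab /IH /= /andP[bl ->]]; rewrite bl (leq_trans ab).
Qed.

Lemma mmset_step_leq (S : mmset) : sorted mmset_step S -> sorted leq (entries S).
Proof.
case: S => // p S /=; rewrite path_map; apply: sub_path => q q' /=.
by rewrite /mmset_step => /andP[].
Qed.

Lemma entries_le_mmax (S : mmset) : is_mmset S ->
  forall a, a \in entries S -> (a <= mmax S)%N.
Proof.
case: S => [//|p S] /and4P[_ _ _ /mmset_step_leq /= /path_leq_last /allP le] a.
by move=> aS; exact: le.
Qed.

Lemma mmin_le_mmax (S : mmset) : is_mmset S -> (mmin S <= mmax S)%N.
Proof.
move=> mS; apply: entries_le_mmax => //.
by case: S mS => // p S _; rewrite inE eqxx.
Qed.

Lemma mmax_rcons (S : mmset) (p : nat * bool) : mmax (rcons S p) = p.1.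
Proof. by rewrite /mmax /entries map_rcons last_rcons. Qed.

Lemma mmin_rcons (S : mmset) (p : nat * bool) :
  mmin (rcons S p) = if S is [::] then p.1 else mmin S.
Proof. by case: S. Qed.

Lemma is_mmset1 (x : nat) (b : bool) : is_mmset [:: (x, b)] = (0 < x)%N && ~~ b.
Proof. by rewrite /is_mmset /= !andbT. Qed.

Lemma is_mmset_rcons (S : mmset) (x : nat) (b : bool) : S != [::] ->
  is_mmset (rcons S (x, b)) =
  [&& is_mmset S, (mmax S <= x)%N & b ==> (mmax S < x)%N].
Proof.
case: S => // p S _.
rewrite /is_mmset /mmax /entries /= rcons_path map_rcons all_rcons /=.
have -> : mmset_step (last p S) (x, b) =
    (last p.1 [seq q.1 | q <- S] <= x)%N && (b ==> (last p.1 [seq q.1 | q <- S] < x)%N).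
  by rewrite /mmset_step last_map.
set l := last _ _; set A := all _ _.
have x0 : (0 < p.1)%N -> A -> (l <= x)%N -> (0 < x)%N.
  rewrite /l /A => p0 pos lx; apply: leq_trans lx.
  have := mem_last p.1 [seq q.1 | q <- S]; rewrite inE => /orP[/eqP -> //|].
  exact: (allP pos).
case: (0 < p.1)%N A (l <= x)%N x0 => [] [] [] //= x0; rewrite ?andbF //.
by rewrite x0 //= andbA.
Qed.

Section MmsetWeight.
Variables (i j : nat).

Lemma mmset_wt1 (x : nat) : mmset_wt i j [:: (x, false)] = var (Xl x).
Proof.
have gen (R : comNzRingType) (f : nat -> R) (z w : R) :
    (\prod_(a <- [:: x]) f a) * z ^+ 0 * w ^+ 0 = f x.
  by rewrite big_seq1 !expr0 !mulr1.
exact: (gen _ (fun a => var (Xl a))).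
Qed.

Lemma mmset_wt_rcons (S : mmset) (x : nat) (b : bool) : is_mmset S ->
  mmset_wt i j (rcons S (x, b)) =
  (if b then - var (Be i) else var (Al j)) * var (Xl x) * mmset_wt i j S.
Proof.
move=> mS.
have eE : entries (rcons S (x, b)) = rcons (entries S) x.
  by rewrite /entries map_rcons.
have mE : marked (rcons S (x, b)) = (marked S + b)%N.
  by rewrite /marked -cats1 count_cat /= addn0.
have uE : (unmarked (rcons S (x, b))).-1 = ((unmarked S).-1 + ~~ b)%N.
  case: S mS {eE mE} => [//|p S] /and4P[_ _ /= p0 _].
  by rewrite /unmarked /= -cats1 count_cat p0 /= addn0.
rewrite /mmset_wt eE mE uE.
have gen (R : comNzRingType) (f : nat -> R) (L : seq nat) (z w : R) (k l : nat) :
    (\prod_(a <- rcons L x) f a) * z ^+ (k + ~~ b) * w ^+ (l + b) =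
    (if b then w else z) * f x * ((\prod_(a <- L) f a) * z ^+ k * w ^+ l).
  rewrite -cats1 big_cat big_seq1 /= !exprD.
  by case: b {eE mE uE} => /=; rewrite expr0 expr1; ring.
exact: (gen _ (fun a => var (Xl a))).
Qed.

Lemma order_mmset_wt (S : mmset) : order_ge (size S) (mmset_wt i j S).
Proof.
rewrite /mmset_wt -mulrA mulrC; apply: order_ge_mull.
elim: S => [|p S IH] /=; first by rewrite big_nil.
by rewrite big_cons -add1n; apply: order_geM IH; exact: order_ge1_var.
Qed.

End MmsetWeight.

Definition tableaux (n : nat) (lam mu r s : 'I_n -> nat) :
    set ('I_n -> nat -> mmset) :=
  [set T | is_mmsvt lam mu T /\ row_flagged lam mu r s T]%classic.

Lemma G_rowE (n : nat) (lam mu r s : 'I_n -> nat) :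
  G_row lam mu r s = fps_sum (tableaux lam mu r s) (mmsvt_wt lam mu).
Proof. by []. Qed.

Lemma order_mmsvt_wt (n : nat) (lam mu : 'I_n -> nat) (T : 'I_n -> nat -> mmset)
    (i : 'I_n) (j : nat) :
  in_skew lam mu i j -> order_ge (size (T i j)) (mmsvt_wt lam mu T).
Proof.
move=> /andP[mj jl].
have -> : mmsvt_wt lam mu T =
    (\prod_(k < n | k != i) \prod_((mu k).+1 <= l < (lam k).+1)
        mmset_wt k.+1 l (T k l)) *
    ((\prod_((mu i).+1 <= l < (lam i).+1 | l != j) mmset_wt i.+1 l (T i l)) *
      mmset_wt i.+1 j (T i j)).
  rewrite /mmsvt_wt (bigD1 i) // (bigD1_seq j) ?iota_uniq //; last first.
    by rewrite mem_index_iota mj.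
  have rev3 (R : comNzRingType) (x y z : R) : x * y * z = z * (y * x) by ring.
  exact: rev3.
by do 2![apply: order_ge_mull]; exact: order_mmset_wt.
Qed.

Lemma finite_bounded_fillings (n C K N : nat) :
  finite_set [set T : 'I_n -> nat -> mmset |
    forall i j, [/\ (C < j)%N -> T i j = [::], (size (T i j) <= N)%N
      & forall a, a \in entries (T i j) -> (a <= K)%N]]%classic.
Proof.
pose mk (f : {ffun 'I_n * 'I_C.+1 -> {bseq N of 'I_K.+1 * bool}})
    (i : 'I_n) (j : nat) : mmset :=
  if (j <= C)%N then [seq (val p.1, p.2) | p <- f (i, inord j)] else [::].
apply: (@sub_finite_set _ _ [set mk f | f in [set: _]]%classic); last first.
  by apply: finite_image; exact: finite_finset.
move=> T /= bT.
exists [ffun c => insub_bseq N [seq (inord q.1, q.2) | q <- T c.1 (val c.2)]] => //.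
apply/funext => i; apply/funext => j; rewrite /mk.
have [Cj sz eK] := bT i j; have [jC|Cj'] := leqP j C; last by rewrite Cj.
rewrite ffunE /= inordK // /insub_bseq insubdK ?unfold_in ?size_map //.
rewrite -map_comp.
rewrite -[RHS]map_id; apply/eq_in_map => -[a b] abT /=; rewrite inordK //.
by rewrite ltnS; apply: eK; apply/mapP; exists (a, b).
Qed.

Lemma summable_tableaux (n : nat) (lam mu r s : 'I_n -> nat) :
  summable (tableaux lam mu r s) (mmsvt_wt lam mu).
Proof.
move=> N; pose C := (\max_(i < n) lam i)%N; pose K := (\max_(i < n) s i)%N.
apply: sub_finite_set (finite_bounded_fillings n C K N) => T [[tT fT] oT] i j.
split.
- move=> Cj; apply: (mmsvt_out tT); apply/negP => /andP[_ jl].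
  have := leq_bigmax (F := lam) i; rewrite -/C => lC; lia.
- have [ij|/(mmsvt_out tT) -> //] := boolP (in_skew lam mu i j).
  have [//|szN] := leqP (size (T i j)) N; case: oT.
  exact: order_geW (ltnW szN) (order_mmsvt_wt ij).
- move=> a; have [ij|/(mmsvt_out tT) -> //] := boolP (in_skew lam mu i j).
  move=> /(entries_le_mmax (mmsvt_in tT ij)) aT; have [_ ms] := fT _ _ ij.
  apply: leq_trans (leq_trans aT ms) _; exact: (leq_bigmax (F := s) i).
Qed.

Lemma mmax_row_mono (n : nat) (lam mu : 'I_n -> nat) (T : 'I_n -> nat -> mmset)
    (i : 'I_n) (j k : nat) :
  is_mmsvt lam mu T -> in_skew lam mu i j -> in_skew lam mu i k -> (j <= k)%N ->
  (mmax (T i j) <= mmax (T i k))%N.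
Proof.
move=> tT ij; elim: k => [|k IH] ik jk.
  by have -> : j = 0%N by lia.
have [->//|jk'] : j = k.+1 \/ (j <= k)%N by lia.
have ik' : in_skew lam mu i k by move: ij ik; rewrite /in_skew; lia.
apply: leq_trans (IH ik' jk') _.
apply: leq_trans (mmsvt_row tT ik' ik) _.
exact: mmin_le_mmax (mmsvt_in tT ik).
Qed.

Definition set_cell (n : nat) (T : 'I_n -> nat -> mmset) (i : 'I_n) (c : nat)
    (S : mmset) (k : 'I_n) (j : nat) : mmset :=
  if (k == i) && (j == c) then S else T k j.

Lemma set_cell_at (n : nat) (T : 'I_n -> nat -> mmset) (i : 'I_n) (c : nat)
    (S : mmset) : set_cell T i c S i c = S.
Proof. by rewrite /set_cell !eqxx. Qed.

Lemma set_cell_out (n : nat) (T : 'I_n -> nat -> mmset) (i k : 'I_n) (c j : nat)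
    (S : mmset) : ~~ ((k == i) && (j == c)) -> set_cell T i c S k j = T k j.
Proof. by rewrite /set_cell => /negPf ->. Qed.

Lemma set_cell_set (n : nat) (T : 'I_n -> nat -> mmset) (i : 'I_n) (c : nat)
    (S S' : mmset) : set_cell (set_cell T i c S) i c S' = set_cell T i c S'.
Proof.
by apply/funext => k; apply/funext => j; rewrite /set_cell; case: (_ && _).
Qed.

Lemma set_cell_id (n : nat) (T : 'I_n -> nat -> mmset) (i : 'I_n) (c : nat) :
  set_cell T i c (T i c) = T.
Proof.
apply/funext => k; apply/funext => j; rewrite /set_cell.
by case: andP => // -[/eqP -> /eqP ->].
Qed.

Section Corner.
Variables (n : nat) (lam mu r : 'I_n -> nat) (i : 'I_n).
Hypothesis row_nonempty : (mu i < lam i)%N.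
Hypothesis corner : forall i' : 'I_n, i' = i.+1 :> nat -> (lam i' < lam i)%N.

Let c := lam i.

Lemma in_skew_dec (k : 'I_n) (j : nat) :
  in_skew (dec lam i) mu k j =
  in_skew lam mu k j && ~~ ((k == i) && (j == c)).
Proof.
have [->|ki] := eqVneq k i; last by rewrite /in_skew dec_neq // andbT.
by rewrite /in_skew dec_id /c /=; apply/idP/idP; lia.
Qed.

Lemma in_skew_corner : in_skew lam mu i c.
Proof. by rewrite /in_skew row_nonempty leqnn. Qed.

Record cell_ok (s : 'I_n -> nat) (T : 'I_n -> nat -> mmset) (S : mmset) : Prop :=
  CellOk {
    cell_mmset : is_mmset S;
    cell_left : in_skew lam mu i c.-1 -> (mmax (T i c.-1) <= mmin S)%N;
    cell_above : forall k : 'I_n, i = k.+1 :> nat -> in_skew lam mu k c ->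
      (mmax (T k c) < mmin S)%N;
    cell_ge : (r i <= mmin S)%N;
    cell_le : (mmax S <= s i)%N
  }.

Lemma cell_ok_set (s : 'I_n -> nat) (T : 'I_n -> nat -> mmset) (S S' : mmset) :
  cell_ok s (set_cell T i c S') S <-> cell_ok s T S.
Proof.
have left' : in_skew lam mu i c.-1 -> set_cell T i c S' i c.-1 = T i c.-1.
  move=> /andP[mc _]; rewrite set_cell_out // eqxx /=.
  by apply/eqP; move: mc; case: c; lia.
have above (k : 'I_n) : i = k.+1 :> nat -> set_cell T i c S' k c = T k c.
  move=> ik; rewrite set_cell_out // eqxx andbT.
  by apply/eqP => ki; rewrite ki in ik; lia.
split=> -[mS lS aS rS sS]; split=> //.
- by move=> h; rewrite -left' //; exact: lS.
- by move=> k ik; rewrite -(above k ik); exact: aS.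
- by move=> h; rewrite left' //; exact: lS.
- by move=> k ik; rewrite (above k ik); exact: aS.
Qed.

Lemma tableaux_cornerP (s : 'I_n -> nat) (T : 'I_n -> nat -> mmset) :
  tableaux lam mu r s T <->
  tableaux (dec lam i) mu r s (set_cell T i c [::]) /\ cell_ok s T (T i c).
Proof.
have sc := in_skew_corner; split.
- move=> [tT fT]; split; last first.
    have [rT sT] := fT _ _ sc; split=> //; first exact: (mmsvt_in tT sc).
    + move=> sc'; have cE : c.-1.+1 = c.
        by rewrite prednK //; move: sc; rewrite /in_skew; lia.
      by have := mmsvt_row tT sc'; rewrite cE; apply.
    + by move=> k ik kc; exact: (mmsvt_col tT ik kc sc).
  split; first split.
  + move=> k j; rewrite in_skew_dec negb_and negbK.
    rewrite /set_cell; case: (_ && _) => //=; rewrite orbF.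
    exact: (mmsvt_out tT).
  + move=> k j; rewrite in_skew_dec => /andP[kj nc]; rewrite set_cell_out //.
    exact: (mmsvt_in tT kj).
  + move=> k j; rewrite !in_skew_dec => /andP[kj nc] /andP[kj' nc'].
    by rewrite !set_cell_out //; exact: (mmsvt_row tT kj kj').
  + move=> k k' j kk'; rewrite !in_skew_dec => /andP[kj nc] /andP[kj' nc'].
    by rewrite !set_cell_out //; exact: (mmsvt_col tT kk' kj kj').
  + move=> k j; rewrite in_skew_dec => /andP[kj nc]; rewrite set_cell_out //.
    exact: fT.
- move=> [[tT fT] [mS lS aS rS sS]].
  have atc k j : in_skew lam mu k j -> k = i /\ j = c \/
      in_skew (dec lam i) mu k j /\ set_cell T i c [::] k j = T k j.
    move=> kj; rewrite in_skew_dec kj /=.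
    case E: ((k == i) && (j == c)); first by case/andP: E => /eqP -> /eqP ->; left.
    by right; split=> //; rewrite set_cell_out // E.
  split; first split.
  + move=> k j kj; have nc : ~~ ((k == i) && (j == c)).
      by apply: contra kj => /andP[/eqP -> /eqP ->].
    rewrite -(set_cell_out T [::] nc); apply: (mmsvt_out tT).
    by rewrite in_skew_dec (negPf kj).
  + move=> k j kj; have [[-> ->] //|[kj' <-]] := atc _ _ kj.
    exact: (mmsvt_in tT kj').
  + move=> k j kj kj'; have [[ki jc]|[dj E]] := atc _ _ kj.
      by move: kj'; rewrite ki jc /in_skew /c; lia.
    have [[ki jc]|[dj' E']] := atc _ _ kj'.
      by move: lS kj; rewrite ki -jc /= => lS kj; exact: lS.
    by rewrite -E -E'; exact: (mmsvt_row tT dj dj').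
  + move=> k k' j kk' kj kj'; have [[ki jc]|[dj E]] := atc _ _ kj.
      have := corner; rewrite ki in kk' *; move=> /(_ _ kk').
      by move: kj'; rewrite jc /in_skew /c; lia.
    have [[ki jc]|[dj' E']] := atc _ _ kj'.
      by move: kj; rewrite ki jc => kj; apply: aS => //; rewrite -ki.
    by rewrite -E -E'; exact: (mmsvt_col tT kk' dj dj').
  + move=> k j kj; have [[-> ->] //|[dj <-]] := atc _ _ kj.
    exact: fT.
Qed.

Lemma mmsvt_wt_corner (T : 'I_n -> nat -> mmset) :
  mmsvt_wt lam mu T =
  mmset_wt i.+1 c (T i c) * mmsvt_wt (dec lam i) mu T.
Proof.
have gen (R : comNzRingType) (f : 'I_n -> nat -> R) :
    \prod_(k < n) \prod_((mu k).+1 <= j < (lam k).+1) f k j =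
    f i c * \prod_(k < n) \prod_((mu k).+1 <= j < (dec lam i k).+1) f k j.
  rewrite (bigD1 i) //= [in RHS](bigD1 i) //= mulrA; congr (_ * _).
    rewrite dec_id prednK; last by lia.
    by rewrite big_nat_recr //= mulrC.
  by apply: eq_bigr => k ki; rewrite dec_neq.
exact: gen _ (fun k j => mmset_wt k.+1 j (T k j)).
Qed.

Lemma mmsvt_wt_set (T : 'I_n -> nat -> mmset) (S : mmset) :
  mmsvt_wt (dec lam i) mu (set_cell T i c S) = mmsvt_wt (dec lam i) mu T.
Proof.
rewrite /mmsvt_wt; apply: eq_bigr => k _; apply: eq_big_nat => j /andP[mj jl].
rewrite set_cell_out //; apply/andP => -[/eqP ki /eqP jc].
by move: jl; rewrite ki jc dec_id /c; lia.
Qed.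

Section Flags.
Variable s : 'I_n -> nat.
Hypothesis lt_above : forall k : 'I_n, i = k.+1 :> nat -> (mu k < lam i)%N ->
  (s k < s i)%N.
Hypothesis flag_nonempty : (0 < r i <= s i)%N.

Let x := s i.

Definition push (b : bool) (T : 'I_n -> nat -> mmset) : 'I_n -> nat -> mmset :=
  set_cell T i c (rcons (T i c) (x, b)).

Lemma push_inj (b : bool) : injective (push b).
Proof.
move=> T T' E; have := congr1 (fun U => U i c) E; rewrite /push !set_cell_at.
move=> /rcons_inj[Tc]; rewrite -[T](set_cell_id T i c) -[T'](set_cell_id T' i c).
rewrite -(set_cell_set T i c (rcons (T i c) (x, b))).
by rewrite -(set_cell_set T' i c (rcons (T' i c) (x, b))) -/(push b T) E /push Tc.
Qed.

Lemma tableaux_decP (T : 'I_n -> nat -> mmset) :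
  tableaux lam mu r (dec s i) T <->
  tableaux lam mu r s T /\ (mmax (T i c) < x)%N.
Proof.
have sc := in_skew_corner; split=> [[tT fT]|[[tT fT] ltx]].
  split; last by have [_] := fT _ _ sc; rewrite dec_id /x; lia.
  split=> // k j kj; have [rT sT] := fT _ _ kj; split=> //.
  exact: leq_trans sT (dec_le _ _ _).
split=> // k j kj; have [rT sT] := fT _ _ kj; split=> //.
have [ki|ki] := eqVneq k i; last by rewrite dec_neq.
rewrite ki dec_id; rewrite ki in kj sT.
have jc : (j <= c)%N by move/andP: kj => [].
have := mmax_row_mono tT kj sc jc; rewrite -/x; lia.
Qed.

Lemma push_tableaux (b : bool) (T : 'I_n -> nat -> mmset) :
  tableaux lam mu r s T -> (b ==> (mmax (T i c) < x)%N) ->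
  tableaux lam mu r s (push b T).
Proof.
move=> /tableaux_cornerP[tT [mS lS aS rS sS]] bx; apply/tableaux_cornerP.
rewrite /push set_cell_at set_cell_set; split=> //; apply/cell_ok_set.
have Tn0 : T i c != [::] by case: (T i c) mS.
have mn : mmin (rcons (T i c) (x, b)) = mmin (T i c).
  by rewrite mmin_rcons; case: (T i c) Tn0.
split; rewrite ?mn ?mmax_rcons //.
by rewrite is_mmset_rcons // mS bx sS.
Qed.

Lemma dec_tableaux_corner (T : 'I_n -> nat -> mmset) :
  tableaux (dec lam i) mu r s T -> T i c = [::].
Proof.
by move=> [tT _]; apply: (mmsvt_out tT); rewrite in_skew_dec !eqxx andbF.
Qed.

Lemma push_dec_tableaux (T : 'I_n -> nat -> mmset) :
  tableaux (dec lam i) mu r s T -> tableaux lam mu r s (push false T).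
Proof.
move=> dT; have Tc := dec_tableaux_corner dT; apply/tableaux_cornerP.
rewrite /push set_cell_at set_cell_set Tc /= -{1}Tc set_cell_id; split=> //.
have [tT fT] := dT; apply/cell_ok_set; split.
- by rewrite is_mmset1 andbT /x; lia.
- move=> ic; have ic' : in_skew (dec lam i) mu i c.-1.
    by rewrite in_skew_dec ic eqxx /=; move: ic; rewrite /in_skew; lia.
  by have [_] := fT _ _ ic'.
- move=> k ik kc; have kc' : in_skew (dec lam i) mu k c.
    rewrite in_skew_dec kc eqxx andbT; apply/eqP => ki.
    by rewrite ki in ik; lia.
  have [_ sk] := fT _ _ kc'; apply: leq_ltn_trans sk _; apply: lt_above => //.
  by move: kc; rewrite /in_skew => /andP[].
- by rewrite /mmin /= -/x; lia.
- by [].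
Qed.

(* Sort by the last element of the corner cell: smaller than [x], or equal to
   [x] and then alone in the cell, unmarked, or marked. *)
Lemma tableaux_split :
  tableaux lam mu r s =
  (tableaux lam mu r (dec s i) `|`
    (push false @` tableaux (dec lam i) mu r s `|`
      (push false @` tableaux lam mu r s `|`
        push true @` tableaux lam mu r (dec s i))))%classic.
Proof.
apply/seteqP; split=> T /=; last first.
  move=> [/tableaux_decP[]//|[[U tU <-]|[[U tU <-]|[U /tableaux_decP[tU Ux] <-]]]].
  - exact: push_dec_tableaux.
  - exact: push_tableaux.
  - exact: push_tableaux.
move=> tT; have [Tx|xT] := ltnP (mmax (T i c)) x.
  by left; apply/tableaux_decP.
right; have /tableaux_cornerP[dT [mS lS aS rS sS]] := tT.
have [S [y [b Tc]]] : exists S y b, T i c = rcons S (y, b).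
  by case/lastP: (T i c) mS => // S [y b] _; exists S, y, b.
have yx : y = x.
  by move: sS xT; rewrite Tc mmax_rcons /= -/x; lia.
rewrite {y}yx in Tc; rewrite Tc in mS lS aS rS sS.
have pushE : push b (set_cell T i c S) = T.
  by rewrite /push set_cell_at set_cell_set -Tc set_cell_id.
case: (eqVneq S [::]) => [S0|Sn0].
  move: mS pushE dT; rewrite S0 is_mmset1 => /andP[_ /negPf ->] E dT.
  by left; exists (set_cell T i c [::]).
have mn : mmin (rcons S (x, b)) = mmin S.
  by rewrite mmin_rcons; case: S Sn0 {Tc mS lS aS rS sS pushE}.
move: mS; rewrite is_mmset_rcons // => /and3P[mS Sx bS].
have tU : tableaux lam mu r s (set_cell T i c S).
  apply/tableaux_cornerP; rewrite set_cell_at set_cell_set; split=> //.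
  by rewrite mn in lS aS rS; apply/cell_ok_set; split.
right; case: b bS pushE {Tc mn lS aS rS sS} => /= bS E.
  right; exists (set_cell T i c S) => //; apply/tableaux_decP.
  by rewrite set_cell_at.
by left; exists (set_cell T i c S).
Qed.

Lemma push_wt_dec (T : 'I_n -> nat -> mmset) :
  tableaux (dec lam i) mu r s T ->
  mmsvt_wt lam mu (push false T) = var (Xl x) * mmsvt_wt (dec lam i) mu T.
Proof.
move=> /dec_tableaux_corner Tc.
by rewrite mmsvt_wt_corner /push set_cell_at mmsvt_wt_set Tc mmset_wt1.
Qed.

Lemma push_wt (b : bool) (T : 'I_n -> nat -> mmset) :
  tableaux lam mu r s T ->
  mmsvt_wt lam mu (push b T) =
  (if b then - var (Be i.+1) else var (Al c)) * var (Xl x) * mmsvt_wt lam mu T.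
Proof.
move=> /tableaux_cornerP[_ [mS _ _ _ _]].
rewrite (mmsvt_wt_corner (push b T)) (mmsvt_wt_corner T) mmsvt_wt_set.
rewrite [push b T i c]set_cell_at (mmset_wt_rcons i.+1 c x b mS).
exact: (esym (mulrA _ _ _)).
Qed.

Lemma G_row_corner :
  (1 - var (Al (lam i)) * var (Xl (s i))) * G_row lam mu r s =
  (1 - var (Be i.+1) * var (Xl (s i))) * G_row lam mu r (dec s i) +
  var (Xl (s i)) * G_row (dec lam i) mu r s.
Proof.
have sT := @summable_tableaux n lam mu r s.
have split4 := tableaux_split.
set A1 := tableaux lam mu r (dec s i) in split4.
set A2 := (push false @` tableaux (dec lam i) mu r s)%classic in split4.
set A3 := (push false @` tableaux lam mu r s)%classic in split4.
set A4 := (push true @` A1)%classic in split4.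
have sub (A : set ('I_n -> nat -> mmset)) :
    (A `<=` A1 `|` (A2 `|` (A3 `|` A4)))%classic -> summable A (mmsvt_wt lam mu).
  by move=> sA; apply: summableW sT; rewrite split4.
have G4 : G_row lam mu r s = G_row lam mu r (dec s i) +
    (var (Xl x) * G_row (dec lam i) mu r s +
      (var (Al c) * var (Xl x) * G_row lam mu r s +
        - var (Be i.+1) * var (Xl x) * G_row lam mu r (dec s i))).
  rewrite [LHS]G_rowE split4 !fps_sumU.
  - congr (_ + (_ + (_ + _))).
    + rewrite fps_sum_image; last exact: push_inj.
      rewrite -fps_sumM; last exact: summable_tableaux.
      by apply: eq_fps_sum => T /push_wt_dec.
    + rewrite fps_sum_image; last exact: push_inj.
      rewrite -fps_sumM; last exact: summable_tableaux.
      by apply: eq_fps_sum => T /push_wt; exact.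
    + rewrite fps_sum_image; last exact: push_inj.
      rewrite -fps_sumM; last exact: summable_tableaux.
      by apply: eq_fps_sum => T /tableaux_decP[/push_wt]; move=> H _; exact: (H true).
  - by apply: sub => T; right; right; left.
  - by apply: sub => T; right; right; right.
  - move=> T [U tU <-] [V /tableaux_decP[_ _] /(congr1 (fun W => W i c))].
    by rewrite /push !set_cell_at => /rcons_inj[].
  - by apply: sub => T; right; left.
  - by apply: sub => T h; right; right.
  - move=> T [U /dec_tableaux_corner Uc <-].
    case=> [[V tV]|[V /tableaux_decP[tV _]]] /(congr1 (fun W => W i c));
      rewrite /push !set_cell_at Uc => /rcons_inj[Vc].
      by have /tableaux_cornerP[_ [+ _ _ _ _]] := tV; rewrite Vc.
    by [].
  - by apply: sub => T; left.
  - by apply: sub => T; right.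
  - move=> T /tableaux_decP[_].
    by move=> + [|[]] [U _ E]; rewrite -E /push set_cell_at mmax_rcons ltnn.
have solve_G (R : comNzRingType) (a b y g g' h : R) :
    g = g' + (y * h + (a * y * g + - b * y * g')) ->
    (1 - a * y) * g = (1 - b * y) * g' + y * h.
  by move=> gE; rewrite mulrBl mul1r {1}gE; ring.
exact: solve_G G4.
Qed.

End Flags.
End Corner.

(** * The recursion *)

Lemma dec_partition (n : nat) (lam : 'I_n -> nat) (i : 'I_n) :
  is_partition lam ->
  (forall i' : 'I_n, i' = i.+1 :> nat -> (lam i' < lam i)%N) ->
  is_partition (dec lam i).
Proof.
move=> lam_part corner j k jk; have ljk := lam_part _ _ jk.
have [ji|ji] := eqVneq j i; last first.
  by rewrite (dec_neq _ ji); exact: (leq_trans (dec_le lam i k) ljk).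
have [ki|ki] := eqVneq k i; first by rewrite ji ki.
rewrite ji in jk *; rewrite dec_id (dec_neq _ ki).
have ik : (i < k)%N.
  by rewrite ltn_neqAle jk andbT; apply: contra ki => /eqP/val_inj ->.
have := corner (Ordinal (leq_ltn_trans ik (ltn_ord k))) erefl.
have := lam_part (Ordinal (leq_ltn_trans ik (ltn_ord k))) k ik; lia.
Qed.

Lemma G_row_equal_rows (n : nat) (lam mu r s : 'I_n -> nat) (i i' : 'I_n) :
    is_partition mu -> (mu i < lam i)%N ->
    i' = i.+1 :> nat -> lam i' = lam i -> s i' = s i ->
  G_row lam mu r s = G_row lam mu r (dec s i).
Proof.
move=> mu_part mli ii' ll ss; rewrite !G_rowE; congr fps_sum.
apply/seteqP; split=> T [tT fT]; split=> // k j kj; have [rT sT] := fT _ _ kj;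
  split=> //; last exact: (leq_trans sT (dec_le s i k)).
have [ki|ki] := eqVneq k i; last by rewrite dec_neq.
rewrite ki in kj *; rewrite dec_id.
have ic : in_skew lam mu i (lam i) by rewrite /in_skew mli leqnn.
have i'c : in_skew lam mu i' (lam i).
  rewrite /in_skew ll leqnn andbT; apply: leq_ltn_trans mli.
  by apply: mu_part; rewrite ii'.
have [_ s'] := fT _ _ i'c.
have jc : (j <= lam i)%N by move/andP: kj => [].
have m1 := mmax_row_mono tT kj ic jc.
have m2 := mmsvt_col tT ii' ic i'c.
have m3 := mmin_le_mmax (mmsvt_in tT i'c).
by rewrite ss in s'; lia.
Qed.

Lemma G_row_empty_flag (n : nat) (lam mu r s : 'I_n -> nat) (i : 'I_n) :
  (mu i < lam i)%N -> (s i < r i)%N -> G_row lam mu r s = 0.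
Proof.
move=> mli sr; rewrite G_rowE; have -> : tableaux lam mu r s = set0.
  apply/seteqP; split=> T // [tT fT].
  have ic : in_skew lam mu i (lam i) by rewrite /in_skew mli leqnn.
  have [rT sT] := fT _ _ ic; have := mmin_le_mmax (mmsvt_in tT ic).
  by rewrite /=; lia.
exact: fps_sum_set0.
Qed.

Lemma G_row_refl (n : nat) (lam mu r s : 'I_n -> nat) :
  lam =1 mu -> G_row lam mu r s = 1.
Proof.
move=> /funext ->; rewrite G_rowE.
have no i j : in_skew mu mu i j = false by rewrite /in_skew; lia.
have -> : tableaux mu mu r s = [set (fun _ _ => [::])]%classic.
  apply/seteqP; split=> T /=; last first.
    move=> ->; split=> [|i j]; last by rewrite no.
    by split=> [i j|i j|i j|i i' j _]; rewrite ?no.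
  move=> [tT _]; apply/funext => i; apply/funext => j.
  by apply: (mmsvt_out tT); rewrite no.
rewrite fps_sum_set1 /mmsvt_wt; apply: big1 => i _.
by rewrite big_geq.
Qed.

(* The last nonempty row whose flag is not forced equal to that of an
   overlapping row above. *)
Lemma exists_active_row (n : nat) (lam mu r s : 'I_n -> nat) (i0 : 'I_n) :
    is_partition lam -> is_partition mu ->
    overlap_mono lam mu r s -> (mu i0 < lam i0)%N ->
  exists i : 'I_n, [/\ (mu i < lam i)%N,
    forall k : 'I_n, i = k.+1 :> nat -> (mu k < lam i)%N -> (s k < s i)%N
  & forall i' : 'I_n, i' = i.+1 :> nat ->
      (lam i' < lam i)%N \/ lam i' = lam i /\ s i' = s i].
Proof.
move=> lam_part mu_part rs ne0.
pose free (i : 'I_n) := (mu i < lam i)%N &&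
  [forall k : 'I_n, (i == k.+1 :> nat) ==> (mu k < lam i)%N ==> (s k < s i)%N].
have [i1 free1] : exists i, free i.
  case: (arg_minnP (P := fun i : 'I_n => (mu i < lam i)%N) val ne0) => i ne min.
  exists i; rewrite /free ne; apply/forallP => k; apply/implyP => /eqP ik.
  apply/implyP => ov; suff : (val i <= val k)%N by rewrite /= ik ltnn.
  by apply: min; apply: leq_trans ov (lam_part _ _ _); rewrite ik.
case: (arg_maxnP (P := free) val free1) => i /andP[ne /forallP fr] max.
exists i; split=> //.
  by move=> k /eqP ik ov; have := fr k; rewrite ik ov.
move=> i' ii'; have ll : (lam i' <= lam i)%N by apply: lam_part; rewrite ii'.
have [l|l] : (lam i' < lam i)%N \/ lam i' = lam i by lia.
  by left.
right; split=> //; have ov : (mu i < lam i')%N by rewrite l.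
have [_ ss] := rs _ _ ii' ov; apply/eqP; rewrite eqn_leq ss andbT leqNgt.
apply/negP => ssl; have := max i'; rewrite /= ii' ltnn.
suff : free i' by move=> -> /(_ isT).
have le_ii' : (i <= i')%N by rewrite ii'.
rewrite /free (leq_ltn_trans (mu_part i i' le_ii') ov) /=.
apply/forallP => k; apply/implyP => /eqP; rewrite ii' => -[ik].
by have -> : k = i by [apply: val_inj]; rewrite ssl implybT.
Qed.

Lemma G_row_jacobi_trudi (n : nat) (lam mu r s : 'I_n -> nat) :
    is_partition lam -> is_partition mu ->
    (forall i, (mu i <= lam i)%N) -> (forall i, (0 < r i)%N) ->
    overlap_mono lam mu r s ->
  G_row lam mu r s = flag_factor r s * jt_det lam mu r s.
Proof.
move=> lam_part mu_part + r_pos.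
have [N] := ubnP (\sum_(i < n) lam i + \sum_(i < n) s i)%N.
elim: N lam s lam_part => // N IH lam s lam_part; rewrite ltnS => sizeN sub rs.
have sum_dec (f : 'I_n -> nat) (i : 'I_n) : (0 < f i)%N ->
    (\sum_(k < n) dec f i k < \sum_(k < n) f k)%N.
  move=> fi; rewrite (bigD1 i) // [X in (_ < X)%N](bigD1 i) //= dec_id.
  have -> : (\sum_(k < n | k != i) dec f i k = \sum_(k < n | k != i) f k)%N.
    by apply: eq_bigr => k ki; rewrite dec_neq.
  by rewrite ltn_add2r; lia.
have [/forallP full|/forallPn[i0 ne0]] := boolP [forall i, lam i == mu i].
  have eq_lam : lam =1 mu by move=> i; exact/eqP.
  by rewrite G_row_refl // jt_det_refl.
have {ne0}ne0 : (mu i0 < lam i0)%N by have := sub i0; lia.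
have [i [ne above below]] := exists_active_row lam_part mu_part rs ne0.
have [ri|sr] := leqP (r i) (s i); last first.
  by rewrite (G_row_empty_flag ne sr) (jt_det_empty_flag lam_part mu_part rs ne sr) mulr0.
have r0 := r_pos i.
have rs_dec : overlap_mono lam mu r (dec s i).
  move=> k k' kk' ov; have [rk sk] := rs _ _ kk' ov; split=> //.
  have [k'i|k'i] := eqVneq k' i.
    rewrite k'i in kk' ov *; have := above _ kk' ov; have := dec_le s i k.
    by rewrite dec_id; lia.
  by rewrite (dec_neq _ k'i); exact: (leq_trans (dec_le s i k) sk).
have IHs : G_row lam mu r (dec s i) = flag_factor r (dec s i) * jt_det lam mu r (dec s i).
  apply: IH => //.
  apply: leq_trans sizeN; rewrite -ltnS ltnS; have := sum_dec s i; lia.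
have fs : (0 < r i <= s i)%N by rewrite r0.
have [corner|[i' [ii' [ll ss]]]] :
    (forall i' : 'I_n, i' = i.+1 :> nat -> (lam i' < lam i)%N) \/
    exists i' : 'I_n, i' = i.+1 :> nat /\ (lam i' = lam i /\ s i' = s i).
  have [/existsP[i' /eqP ii']|/existsPn no] :=
    boolP [exists i' : 'I_n, i' == i.+1 :> nat].
    have [l|l] := below _ ii'; last by right; exists i'.
    left=> k ki; have -> // : k = i' by apply: val_inj; rewrite /= ki ii'.
  by left=> i' /eqP ii'; have := no i'; rewrite ii'.
- have IHl : G_row (dec lam i) mu r s = flag_factor r s * jt_det (dec lam i) mu r s.
    apply: IH.
    + exact: dec_partition.
    + by have := sum_dec lam i; lia.
    + move=> k; have [->|ki] := eqVneq k i; last by rewrite dec_neq.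
      by rewrite dec_id; lia.
    + move=> k k' kk' ov; apply: rs => //.
      exact: (leq_trans ov (dec_le lam i k')).
  have eqG := @G_row_corner n lam mu r i ne corner s above fs.
  have eqD := @jt_det_corner n lam mu r s lam_part mu_part i rs r0 ne ri.
  have eqF := @flag_factor_dec n r s i fs.
  rewrite IHs IHl in eqG.
  apply/eqP; rewrite -subr_eq0; apply/eqP.
  apply: (@order_fix _ (var (Al (lam i)) * var (Xl (s i)))).
    by apply: order_ge_mull; exact: order_ge1_var.
  have cancel (R : comNzRingType) (a x b g d d1 d2 f f1 : R) :
      (1 - a * x) * g = (1 - b * x) * (f1 * d1) + x * (f * d2) ->
      (1 - a * x) * d = d1 + x * d2 -> f = (1 - b * x) * f1 ->
      g - f * d = a * x * (g - f * d).
    move=> gE dE fE; apply/eqP; rewrite -subr_eq0; apply/eqP.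
    transitivity ((1 - a * x) * g - f * ((1 - a * x) * d)); first by ring.
    by rewrite gE dE fE; ring.
  exact: cancel eqG eqD eqF.
- rewrite (G_row_equal_rows r mu_part ne ii' ll ss) IHs.
  rewrite (jt_det_equal_rows lam_part mu_part rs r0 ne ri ii' ll ss).
  have regroup (R : comNzRingType) (a f d : R) : f * (a * d) = a * f * d by ring.
  by rewrite (flag_factor_dec fs); exact: regroup.
Qed.

Theorem theorem6p6 (n : nat) (lam mu r s : 'I_n -> nat)
    (lam_part : is_partition lam) (mu_part : is_partition mu)
    (mu_sub_lam : forall i : 'I_n, (mu i <= lam i)%N)
    (r_pos : forall i : 'I_n, (0 < r i)%N)
    (s_pos : forall i : 'I_n, (0 < s i)%N)
    (rs_mono : forall i i' : 'I_n, i' = i.+1 :> nat -> (mu i < lam i')%N ->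
       (r i <= r i')%N /\ (s i <= s i')%N) :
  G_row lam mu r s =
  (\prod_(i < n) \prod_(r i <= l < (s i).+1)
      (1 - var (Be i.+1) * var (Xl l))) *
  \det (\matrix_(i < n, j < n)
    h_ominus ((lam i)%:Z - (mu j)%:Z - i%:Z + j%:Z)
      (xs (r j) (s i))
      (alphas (lam i) - alphas (mu j) - betas i + betas j.+1)).
Proof. exact: G_row_jacobi_trudi. Qed.
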